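(* Let $p$ be a prime, let $\alpha,\beta,\gamma\in\overline{\mathbb F}_p$ be the roots (with multiplicity) of $T(X)=X^3-X-1\in\mathbb F_p[X]$, let $R_p=\mathbb F_p(\alpha,\beta,\gamma)$ and $r_p=[R_p:\mathbb F_p]\in\{1,2,3\}$. Let $a,b,c$ be the multiplicative orders of $\alpha,\beta,\gamma$ in $R_p^\times$, and let $t_p,\Omega_p,\omega_p,A_p$ be the period, divisibility set, first-occurrence index and truncated divisibility set of the Padovan sequence modulo $p$ (defined in the context). Then: 1) For all $p$: $t_p-3,\ t_p-2,\ t_p\in A_p$; hence $\omega_p\le t_p-3$. 2) $\Omega_p=A_p+\mathbb N t_p=\{x+kt_p : x\in A_p,\ k\in\mathbb N\}$, where $\mathbb N=\{0,1,2,\dots\}$. 3) If $p\ne 23$, then $t_p=\operatorname{lcm}(a,b,c)$, and $t_p$ divides $p^{r_p}-1$. 4) If $p=23$, then $t_{23}=506=p(p-1)$ and $r_p=1$. 5) Moreover: (i) $r_p=1$ if and only if there exist integers $x,y$ with $p=x^2+23y^2$. (ii) If $r_p=2$, then $T$ has a root in $\mathbb F_p$ and, naming the roots so that $\alpha\in\mathbb F_p$, one has: $t_p=b=c$; $b$ divides $(p+1)a$; and $\omega_p\le (p+1)\,o(\alpha^3)-3$, where $o(\alpha^3)$ is the multiplicative order of $\alpha^3$. (iii) If $r_p=3$, then $t_p=a=b=c$, and this number divides $\frac{p^3-1}{p-1}=p^2+p+1$.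
   Context: The Padovan sequence $(T_n)_{n\ge 0}$ is the integer sequence defined by $T_0=0$, $T_1=1$, $T_2=1$ and $T_{n+3}=T_{n+1}+T_n$ for all $n\ge 0$. For a prime $p$: - $t_p=\min\{n\ge 1 : T_n\equiv 0,\ T_{n+1}\equiv 1,\ T_{n+2}\equiv 1 \pmod p\}$ is the period of $(T_n)_{n\ge0}$ modulo $p$; - $\Omega_p=\{n\ge 1 : p \mid T_n\}$; - $\omega_p=\min\Omega_p$; - $A_p=\Omega_p\cap\{1,2,\dots,t_p\}$. $R_p$ is the splitting field over $\mathbb F_p$ of $X^3-X-1$. *)

(* Defs.v *)
From mathcomp Require Import all_boot all_order all_fingroup all_algebra all_field.

Set Implicit Arguments.
Unset Strict Implicit.
Unset Printing Implicit Defensive.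

Import GRing.Theory.

Fixpoint padovan (n : nat) : nat :=
  match n with
  | 0 => 0
  | 1 => 1
  | 2 => 1
  | (m.+1 as m1).+2 => padovan m1 + padovan m
  end.

Definition is_period (p : nat) : pred nat :=
  [pred n | [&& 0 < n, padovan n == 0 %[mod p],
                padovan n.+1 == 1 %[mod p] & padovan n.+2 == 1 %[mod p]]].

Definition Omega (p : nat) : pred nat := [pred n | (0 < n) && (p %| padovan n)].

(* The recurrence is reversible, hence purely periodic modulo [p]. *)
Lemma period_exists (p : nat) : prime p -> exists n, is_period p n.
Proof.
move=> p_pr.
pose f (s : 'F_p * 'F_p * 'F_p) : 'F_p * 'F_p * 'F_p := (s.1.2, s.2, (s.1.1 + s.1.2)%R).
have f_inj : injective f.
  case=> [[x y] z] [[x' y'] z']; rewrite /f /= => /eqP.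
  rewrite !xpair_eqE => /andP[/andP[/eqP-> /eqP->]].
  by rewrite (inj_eq (GRing.addIr _)) => /eqP->.
pose st n : 'F_p * 'F_p * 'F_p :=
  ((padovan n)%:R, (padovan n.+1)%:R, (padovan n.+2)%:R)%R.
have st_iter n : iter n f (st 0) = st n.
  by elim: n => //= n ->; rewrite /f /st /= -natrD addnC.
have natF m n : (m%:R = n%:R :> 'F_p)%R -> m == n %[mod p].
  by move=> /(congr1 val); rewrite /= !val_Fp_nat // => ->.
have [n_gt0 st_n] := (fingraph.order_gt0 f (st 0), fingraph.iter_order f_inj (st 0)).
exists (fingraph.order f (st 0)); apply/and4P; split; first exact: n_gt0.
all: by move: st_n; rewrite st_iter => -[e0 e1 e2]; apply: natF.
Qed.

Lemma Omega_nonempty (p : nat) : prime p -> exists n, n \in Omega p.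
Proof.
case/period_exists=> n /and4P[n_gt0 /eqP pn _ _]; exists n.
by rewrite inE n_gt0 /dvdn pn mod0n.
Qed.

Definition period (p : nat) (p_pr : prime p) : nat := ex_minn (period_exists p_pr).

Definition omega (p : nat) (p_pr : prime p) : nat := ex_minn (Omega_nonempty p_pr).

Definition Omega_upto_period (p : nat) (p_pr : prime p) : pred nat :=
  [pred n | (n \in Omega p) && (1 <= n <= period p_pr)].

Definition padovan_poly (K : nzRingType) : {poly K} := ('X^3 - 'X - 1)%R.

(* [finvect_type L] is [L] with its finite field structure; [mult_order 0] is
   the junk value 1. *)
Definition mult_order (p : nat) (L : fieldExtType 'F_p) (x : L) : nat :=
  #[insubd (1%g : {unit finvect_type L}) x]%g.

(* Main.v *)
(* All the items but 5 (i) follow from the action of the Frobenius on the roots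
   and from X^(n+3) = T_n X^2 + T_(n+1) X + (T_(n+2) - T_n) modulo X^3 - X - 1.
   For 5 (i), the discriminant of X^3 - X - 1 is -23, so for p other than 2, 3, 23
   the Frobenius fixes all the roots or permutes them cyclically if and only if
   -23 is a square modulo p, i.e. p is a value of x^2 + xy + 6y^2 or of
   2x^2 + xy + 3y^2. The cube of the Lagrange resolvent is, up to a cube, the unit
   (sqrt(-23) - 3 sqrt(-3)) / 2, and the roots are fixed when it is a cubic
   residue at p. If A^2 + 23 B^2 = 4 k p with k = 1 or 2, it may be replaced by the
   Eisenstein integer mu = (A + 3 B sqrt(-3)) / 2, of norm k p + B^2. Cubic
   reciprocity between mu and rational integers, proved with Gauss sums, turns the
   symbol (mu / k p) into (mu / B)^2 or (mu / A)^2, which is 1; so (mu / p) = 1 if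
   k = 1, and (mu / p) = (mu / 2)^-1, which is not 1, if k = 2. *)
Require Import Defs.
From mathcomp Require Import all_boot all_order all_fingroup all_algebra all_field.
From mathcomp Require Import ring lra zify.

Set Implicit Arguments.
Unset Strict Implicit.
Unset Printing Implicit Defensive.

Import Order.TTheory GRing.Theory Num.Theory.

Local Open Scope ring_scope.

(** * Frobenius and cube roots of unity *)

(** Eisenstein integers are pairs of integers, evaluated at [w] and [w ^+ 2] in a closed field of
    characteristic [q]. The symbol at a rational prime sees only the ratio of these two values, so
    rational factors cancel. This is why [mu] can replace the resolvent: modulo p one has
    [delta = A / B] up to sign, and clearing the denominator changes nothing. It also makes the
    symbol of sqrt(-3) trivial, since conjugation negates it and ['Z_3] has no 2-torsion.

    Reciprocity is stated as a property of one element: as a function of the prime [q], its symbol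
    extends to a multiplicative function, periodic modulo the norm. To prove it, an element is split
    into factors for which it is known, namely rational integers and Jacobi sums; the latter provide
    elements of norm [q] for every prime [q = 1 mod 3].

    The prime 3 is the obstacle, as the symbol there is meaningless. Hence the two choices [A] and
    [B]: the one prime to 3 is used, and when [mu] is not primary it is divided by 3, and then by
    sqrt(-3) and a unit as needed, which raises the modulus by a factor 9. *)

Section Frobenius.
Variables (R : comNzRingType) (p : nat).
Hypothesis charp : p \in [pchar R].

Lemma frobD (x y : R) : (x + y) ^+ p = x ^+ p + y ^+ p.
Proof. exact: (pFrobenius_autD_comm charp (mulrC x y)). Qed.

Lemma frobN (x : R) : (- x) ^+ p = - x ^+ p.
Proof. exact: (pFrobenius_autN charp x). Qed.

Lemma frobB (x y : R) : (x - y) ^+ p = x ^+ p - y ^+ p.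
Proof. by rewrite frobD frobN. Qed.

Lemma frob_nat n : (n%:R : R) ^+ p = n%:R.
Proof. exact: (pFrobenius_aut_nat charp n). Qed.

Lemma frob_int (n : int) : (n%:~R : R) ^+ p = n%:~R.
Proof.
case: n => n; first exact: frob_nat.
by rewrite NegzE intrN frobN -!pmulrn frob_nat.
Qed.

Lemma frob_sum (I : Type) (r : seq I) (P : pred I) (E : I -> R) :
  (\sum_(i <- r | P i) E i) ^+ p = \sum_(i <- r | P i) E i ^+ p.
Proof. exact: (rmorph_sum (pFrobenius_aut charp)). Qed.

End Frobenius.

Lemma natr_eq0_char (R : nzRingType) p n :
  p \in [pchar R] -> (n%:R == 0 :> R) = (p %| n)%N.
Proof. by move=> cp; rewrite -(dvdn_pcharf cp). Qed.

Lemma natr_eq_char (R : nzRingType) p m n : p \in [pchar R] ->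
  (m%:R == n%:R :> R) = (m == n %[mod p])%N.
Proof.
move=> cp; wlog le_nm : m n / (n <= m)%N.
  by move=> hw; case/orP: (leq_total m n) => /hw // h; rewrite eq_sym h eq_sym.
by rewrite -subr_eq0 -natrB // (natr_eq0_char _ cp) eqn_mod_dvd.
Qed.

Lemma intr_eq0_char (R : nzRingType) p (n : int) :
  p \in [pchar R] -> (n%:~R == 0 :> R) = (p %| `|n|)%N.
Proof.
move=> cp; case: n => n; first exact: natr_eq0_char.
by rewrite NegzE intrN oppr_eq0 -pmulrn (natr_eq0_char _ cp) abszN.
Qed.


Section CubeRoot.
Variables (F : fieldType) (w : F).
Hypothesis (w0 : w ^+ 2 + w + 1 = 0) (F3 : (3%:R : F) != 0).

Lemma cube_rootX2 : w ^+ 2 = - w - 1.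
Proof. by apply/eqP; rewrite -subr_eq0 -w0; apply/eqP; ring. Qed.

Lemma cube_root3 : w ^+ 3 = 1.
Proof. by have w2 := cube_rootX2; rewrite exprS w2; ring: w2. Qed.

Lemma cube_root_neq1 : w != 1.
Proof.
apply/eqP => w1; move: w0 F3; rewrite w1 expr1n => h.
by rewrite -[3%N]/(1 + 1 + 1)%N !natrD h eqxx.
Qed.

Lemma cube_root_neq0 : w != 0.
Proof.
by apply/eqP => e; move/eqP: cube_root3; rewrite e expr0n /= eq_sym oner_eq0.
Qed.

Lemma cube_root_prim : 3.-primitive_root w.
Proof.
have [m mP] := prim_order_exists (isT : (0 < 3)%N) cube_root3.
case: m mP => [|[|[|[|m]]]] // mP _.
by have := prim_expr_order mP; rewrite expr1 => /eqP; rewrite (negPf cube_root_neq1).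
Qed.

Lemma expZ3D (i j : 'Z_3) : w ^+ (i + j)%R = w ^+ i * w ^+ j.
Proof. by rewrite -exprD [val _]/= (expr_mod _ cube_root3). Qed.

Lemma expZ3_inj : injective (fun i : 'Z_3 => w ^+ i).
Proof.
move=> i j /eqP; rewrite (eq_prim_root_expr cube_root_prim) => /eqP e.
by apply: val_inj; rewrite /= -[LHS](modn_small (ltn_ord i)) e modn_small.
Qed.

Lemma expZ3N (i : 'Z_3) : w ^+ (- i)%R = (w ^+ i)^-1.
Proof.
apply: (mulfI (expf_neq0 i cube_root_neq0)); rewrite -expZ3D subrr expr0.
by rewrite mulfV // expf_neq0 // cube_root_neq0.
Qed.

Lemma expZ3_nat n : w ^+ (n%:R : 'Z_3) = w ^+ n.
Proof. by rewrite -[in RHS](expr_mod _ cube_root3) val_Zp_nat. Qed.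

Lemma cubed_eq1 (y : F) : y ^+ 3 = 1 -> exists i : 'Z_3, y = w ^+ i.
Proof.
move=> /eqP; rewrite -subr_eq0.
have -> : y ^+ 3 - 1 = (y - 1) * (y - w) * (y - w ^+ 2).
  by have w2 := cube_rootX2; rewrite w2; ring: w2.
rewrite !mulf_eq0 !subr_eq0 => /orP[/orP[]|] /eqP ->.
- by exists 0.
- by exists 1.
- by exists 2%:R.
Qed.

Lemma cube_root_sqr : (w ^+ 2) ^+ 2 + w ^+ 2 + 1 = 0.
Proof. by have w2 := cube_rootX2; rewrite w2; ring: w2. Qed.

End CubeRoot.

(** * Eisenstein integers and cubic residue symbols *)

(* (a, b) stands for a + b w, where w ^+ 2 + w + 1 = 0. *)
Definition eis : Type := int * int.
Definition emul (e f : eis) : eis :=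
  (e.1 * f.1 - e.2 * f.2, e.1 * f.2 + e.2 * f.1 - e.2 * f.2).
Definition econj (e : eis) : eis := (e.1 - e.2, - e.2).
Definition enormz (e : eis) : int := e.1 ^+ 2 - e.1 * e.2 + e.2 ^+ 2.
Definition enorm (e : eis) : nat := `|enormz e|.
Definition ev (R : nzRingType) (w : R) (e : eis) : R := e.1%:~R + e.2%:~R * w.

Lemma enormzM e f : enormz (emul e f) = enormz e * enormz f.
Proof. by rewrite /enormz /=; ring. Qed.

Lemma enormM e f : enorm (emul e f) = (enorm e * enorm f)%N.
Proof. by rewrite /enorm enormzM abszM. Qed.

Lemma enormz_conj e : enormz (econj e) = enormz e.
Proof. by rewrite /enormz /=; ring. Qed.

Lemma enormz_ge0 e : 0 <= enormz e.
Proof. by rewrite /enormz; nia. Qed.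

Lemma enormE e : (enorm e)%:Z = enormz e.
Proof. by rewrite /enorm gez0_abs // enormz_ge0. Qed.

Section Eval.
Variables (F : fieldType) (w : F).
Hypothesis (w0 : w ^+ 2 + w + 1 = 0).
Let w2 := cube_rootX2 w0.

Lemma evM e f : ev w (emul e f) = ev w e * ev w f.
Proof. by rewrite /ev /= !(rmorphB, rmorphD, rmorphM) /=; ring: w2. Qed.

Lemma ev_conj e : ev w (econj e) = ev (w ^+ 2) e.
Proof. by rewrite /ev /= w2 !(rmorphB, rmorphN) /=; ring. Qed.

Lemma ev_norm e : ev w e * ev (w ^+ 2) e = (enorm e)%:R.
Proof.
rewrite -[RHS]/((enorm e)%:Z%:~R) enormE /ev /enormz w2.
by rewrite !(rmorphB, rmorphD, rmorphM, rmorphXn) /=; ring: w2.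
Qed.

Lemma ev_norm_neq0 q e : q \in [pchar F] -> ~~ (q %| enorm e)%N ->
  ev w e != 0 /\ ev (w ^+ 2) e != 0.
Proof.
move=> cq; rewrite -(natr_eq0_char _ cq) -ev_norm mulf_eq0 negb_or.
by case/andP.
Qed.

(** The two values differ by [e.2 * (w - w ^+ 2)], and [w] differs from its square outside
    characteristic 3. So vanishing at both evaluations is divisibility by [q]. *)
Lemma ev_inj0 q e : q \in [pchar F] -> (3%:R : F) != 0 ->
  ev w e = 0 -> ev (w ^+ 2) e = 0 -> (q %| `|e.1|)%N /\ (q %| `|e.2|)%N.
Proof.
move=> cq F3 h1 h2.
have e2 : (e.2)%:~R = 0 :> F.
  have: (e.2)%:~R * (w - w ^+ 2) = 0 :> F.
    by rewrite -[RHS](subrr 0) -{1}h1 -h2 /ev; ring.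
  move/eqP; rewrite mulf_eq0 => /orP[/eqP //|]; rewrite subr_eq0 => /eqP ww.
  have: w * (w - 1) = 0 by rewrite mulrBr mulr1 -expr2 -ww subrr.
  move/eqP; rewrite mulf_eq0 subr_eq0 (negPf (cube_root_neq1 w0 F3)).
  by rewrite (negPf (cube_root_neq0 w0)).
move: h1; rewrite /ev e2 mul0r addr0 => e1.
by rewrite -!(intr_eq0_char _ cq) e1 e2 eqxx.
Qed.

End Eval.

(** One closed field per characteristic holds the cube roots of unity, the [l]-th roots of unity of
    the Gauss sums and the roots of the cubic. *)
Definition Fbar (q : nat) : countClosedFieldType :=
  tag (countable_algebraic_closure 'F_q).

Lemma Fbar_char q : prime q -> q \in [pchar (Fbar q)].
Proof.
move=> qP; rewrite /Fbar; case: countable_algebraic_closure => K [f _] /=.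
by rewrite (fmorph_pchar f) pchar_Fp.
Qed.

Lemma closed_cube_root (F : closedFieldType) : exists w : F, w ^+ 2 + w + 1 == 0.
Proof.
have [w hw] := @solve_monicpoly F 2 (fun _ => -1) isT.
by exists w; rewrite hw big_ord_recl big_ord1 /= expr0 expr1; apply/eqP; ring.
Qed.

(** The choice of root does not affect [csym]: exchanging [om q] and its square inverts both the
    ratio of evaluations and the root that its power is compared with. *)
Definition om q : Fbar q := xchoose (closed_cube_root (Fbar q)).

Lemma om0 q : om q ^+ 2 + om q + 1 = 0.
Proof. exact/eqP/(xchooseP (closed_cube_root (Fbar q))). Qed.

(* Exponent i of the cubic residue symbol (e / q) = w ^+ i, for a rational prime
   q != 3. When q = 1 mod 3, this is the product of the symbols at the two
   primes above q, whence the quotient by the conjugate; (q + 1) %/ 3 is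
   (q - 1) / 3 or (q + 1) / 3. The value is junk if q divides the norm of e. *)
Definition csym (q : nat) (e : eis) : 'Z_3 :=
  let x := ev (om q) e in let x' := ev (om q ^+ 2) e in
  let y := (if (q %% 3 == 1)%N then x / x' else x' / x) ^+ ((q + 1) %/ 3) in
  if y == 1 then 0 else if y == om q then 1 else 2%:R.

Section Csym.
Variable q : nat.
Hypotheses (q_pr : prime q) (q3 : q != 3%N).

Let cq := Fbar_char q_pr.
Let w := om q.
Let w0 : w ^+ 2 + w + 1 = 0 := om0 q.
Let w2 := cube_rootX2 w0.

Fact Fbar3 : (3%:R : Fbar q) != 0.
Proof. by rewrite (natr_eq0_char _ cq) dvdn_prime2. Qed.

Lemma prime_mod3 : q = (3 * ((q + 1) %/ 3) + 1)%N /\ (q %% 3 = 1)%N \/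
  q = (3 * ((q + 1) %/ 3) - 1)%N /\ (q %% 3 = 2)%N.
Proof.
have : (q %% 3 != 0)%N by rewrite -/(dvdn _ _) dvdn_prime2 // eq_sym.
by clear; lia.
Qed.

Lemma ev_frob1 e : (q %% 3 = 1)%N -> ev w e ^+ q = ev w e.
Proof.
move=> h; rewrite /ev (frobD cq) exprMn !(frob_int cq).
have ->: w ^+ q = w by rewrite -(expr_mod _ (cube_root3 w0)) h.
by [].
Qed.

Lemma ev_frob1' e : (q %% 3 = 1)%N -> ev (w ^+ 2) e ^+ q = ev (w ^+ 2) e.
Proof. by rewrite -!(ev_conj w0); exact: ev_frob1. Qed.

Lemma ev_frob2 e : (q %% 3 = 2)%N -> ev w e ^+ q = ev (w ^+ 2) e.
Proof.
move=> h; rewrite /ev (frobD cq) exprMn !(frob_int cq).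
have ->: w ^+ q = w ^+ 2 by rewrite -(expr_mod _ (cube_root3 w0)) h.
by [].
Qed.

Lemma econjK : involutive econj.
Proof. by case=> a b; rewrite /econj /=; congr pair; ring. Qed.

Lemma ev_frob2' e : (q %% 3 = 2)%N -> ev (w ^+ 2) e ^+ q = ev w e.
Proof.
rewrite -(ev_conj w0) => h; rewrite ev_frob2 // -(ev_conj w0).
by rewrite econjK.
Qed.

Lemma csymE e : ~~ (q %| enorm e)%N ->
  w ^+ csym q e = (if (q %% 3 == 1)%N then ev w e / ev (w ^+ 2) e
                   else ev (w ^+ 2) e / ev w e) ^+ ((q + 1) %/ 3).
Proof.
move=> qe; rewrite /csym -/w; lazy zeta; set y := (X in _ = X); rewrite -/y.
have [n1 n2] := ev_norm_neq0 w0 cq qe.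
(* Cubing turns the exponent into [q - 1] or [q + 1]. In the first case Frobenius fixes both
   evaluations; in the second it exchanges them, hence inverts their ratio. *)
have y3 : y ^+ 3 = 1.
  rewrite /y -exprM mulnC; case: prime_mod3 => -[qE qm]; rewrite qm /=.
    have -> : (3 * ((q + 1) %/ 3) = q.-1)%N by lia.
    apply: (mulfI (mulf_neq0 n1 (invr_neq0 n2))).
    rewrite -exprS prednK ?prime_gt0 // mulr1 expr_div_n.
    by rewrite ev_frob1 ?ev_frob1'.
  have -> : (3 * ((q + 1) %/ 3) = q.+1)%N by lia.
  rewrite exprS expr_div_n ev_frob2 ?ev_frob2' //.
  by rewrite -[X in _ * X]invf_div mulfV // mulf_neq0 ?invr_neq0.
have [i ->] := cubed_eq1 w0 y3.
have inj := expZ3_inj w0 Fbar3.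
have h0 : (w ^+ i == 1) = (i == 0) by rewrite -(inj_eq inj i 0).
have h1 : (w ^+ i == w) = (i == 1) by rewrite -(inj_eq inj i 1).
by rewrite h0 h1; clear; case: i => [[|[|[|i]]] hi].
Qed.

Lemma csym_uniq e (i : 'Z_3) : ~~ (q %| enorm e)%N ->
  (if (q %% 3 == 1)%N then ev w e / ev (w ^+ 2) e
                   else ev (w ^+ 2) e / ev w e) ^+ ((q + 1) %/ 3) = w ^+ i ->
  csym q e = i.
Proof. by move=> qe; rewrite -csymE // => /(expZ3_inj w0 Fbar3). Qed.

Lemma csymM e f : ~~ (q %| enorm (emul e f))%N ->
  csym q (emul e f) = csym q e + csym q f.
Proof.
move=> qef; move: (qef); rewrite enormM Euclid_dvdM // negb_or => /andP[qe qf].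
apply: csym_uniq => //; rewrite (expZ3D w0) !csymE // -exprMn.
congr (_ ^+ _); rewrite -!(ev_conj w0).
have -> : econj (emul e f) = emul (econj e) (econj f).
  by rewrite /econj /emul /=; congr pair; ring.
by rewrite !(evM w0); case: ifP => _; rewrite invfM; ring.
Qed.

Lemma csym_conj e : ~~ (q %| enorm e)%N -> csym q (econj e) = - csym q e.
Proof.
move=> qe; apply: csym_uniq; first by rewrite /enorm enormz_conj.
rewrite (expZ3N w0) csymE // -!(ev_conj w0) econjK -exprVn.
by congr (_ ^+ _); case: ifP => _; rewrite invf_div.
Qed.

(** The rational factor [u] cancels in the ratio of the two evaluations. This is the device that
    replaces an element by sqrt(-3), by 1 or by [w] modulo a well chosen prime. *)
Lemma csym_mod (e f : eis) (u : int) :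
  ~~ (q %| enorm f)%N -> ~~ (q %| `|u|)%N ->
  (q %| `|(e.1 - u * f.1)%R|)%N -> (q %| `|(e.2 - u * f.2)%R|)%N ->
  ~~ (q %| enorm e)%N /\ csym q e = csym q f.
Proof.
move=> qf qu; rewrite -!(intr_eq0_char _ cq) !intrB !intrM.
rewrite !subr_eq0 => /eqP e1 /eqP e2.
have hev (v : Fbar q) : ev v e = u%:~R * ev v f by rewrite /ev e1 e2; ring.
have u0 : (u%:~R : Fbar q) != 0 by rewrite (intr_eq0_char _ cq).
have qe : ~~ (q %| enorm e)%N.
  have [n1 n2] := ev_norm_neq0 w0 cq qf.
  rewrite -(natr_eq0_char _ cq) -(ev_norm w0) !hev.
  by rewrite !mulf_neq0.
split; first by rewrite (intr_eq0_char _ cq).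
apply: csym_uniq => //; rewrite csymE //!hev.
by congr (_ ^+ _); case: ifP => _; rewrite invfM mulrACA mulfV // mul1r.
Qed.

Lemma csym1 : csym q (1, 0) = 0.
Proof.
apply: csym_uniq; first by rewrite /enorm /enormz /= dvdn1 neq_ltn prime_gt1 ?orbT.
by rewrite /ev /= !mul0r !addr0 divr1 if_same expr1n.
Qed.

Lemma double_Z3_eq0 (i : 'Z_3) : i + i = 0 -> i = 0.
Proof. by case: i => [[|[|[|i]]] hi] //= _; apply: val_inj. Qed.

(** Here [1 + 2 w] is sqrt(-3). Conjugation negates it, so its ratio is -1 and twice its symbol is
    0. *)
Lemma csym_s3 : csym q (1, 2%:R) = 0.
Proof.
have h : ~~ (q %| enorm ((1, 2%:R)%R : eis))%N by rewrite /enorm /enormz /= dvdn_prime2.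
have [_ n2] := ev_norm_neq0 w0 cq h.
apply/double_Z3_eq0/(expZ3_inj w0 Fbar3); rewrite /= (expZ3D w0) csymE // expr0.
have -> : ev w (1, 2%:R) = - ev (w ^+ 2) (1, 2%:R).
  by rewrite /ev /= w2; ring.
by rewrite invrN mulrN mulNr mulfV // if_same -exprD addnn -mul2n exprM sqrrN !expr1n.
Qed.

(** With [q = 3 m + 1] the ratio is [w ^+ 2] and the exponent [2 m]; with [q = 3 m - 1] the ratio is
    [w] and the exponent [m]. Both agree with [(q ^ 2 - 1) / 3] modulo 3. *)
Lemma csym_om : csym q (0, 1) = (((q ^ 2 - 1) %/ 3)%:R).
Proof.
apply: csym_uniq; first by rewrite /enorm /enormz /= dvdn1 neq_ltn prime_gt1 ?orbT.
rewrite (expZ3_nat w0) /ev /= !add0r !mul1r.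
have wn := cube_root_neq0 w0.
have -> : w / w ^+ 2 = w ^+ 2.
  by apply: (mulIf (expf_neq0 2 wn)); rewrite divfK ?expf_neq0 // -exprD -[(2+2)%N]/(1+3)%N exprD (cube_root3 w0) mulr1 expr1.
have -> : w ^+ 2 / w = w by rewrite expr2 mulfK.
have w3n m n : m = n %[mod 3] -> w ^+ m = w ^+ n.
  by move=> mn; rewrite -(expr_mod _ (cube_root3 w0)) mn (expr_mod _ (cube_root3 w0)).
case: prime_mod3 => -[qE qm]; rewrite qm /=; first rewrite -exprM; apply: w3n.
  move: ((q + 1) %/ 3)%N qE => m ->.
  have -> : ((3 * m + 1) ^ 2 - 1 = (3 * m ^ 2 + 2 * m) * 3)%N by nia.
  by rewrite mulnK // [(3 * _)%N]mulnC modnMDl.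
move: ((q + 1) %/ 3)%N qE (prime_gt0 q_pr) => [|m] qE q_gt0; first by lia.
have -> : (q = 3 * m + 2)%N by lia.
have -> : ((3 * m + 2) ^ 2 - 1 = ((m ^ 2 + m) * 3 + m.+1) * 3)%N by nia.
by rewrite mulnK // modnMDl.
Qed.

End Csym.

(** * Gauss and Jacobi sums *)

Definition Z3coord (i : 'Z_3) : eis :=
  if i == 0 then (1, 0) else if i == 1 then (0, 1) else (-1, -1).

Lemma ev_Z3coord (F : fieldType) (w : F) i : w ^+ 2 + w + 1 = 0 ->
  ev w (Z3coord i) = w ^+ i.
Proof.
move=> /cube_rootX2 w2; case: i => [[|[|[|i]]] hi] //; rewrite /ev /= ?w2; ring.
Qed.

Lemma Z3coord2 i : (Z3coord i).2%:~R = i :> 'Z_3.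
Proof. by case: i => [[|[|[|i]]] hi] //; apply: val_inj. Qed.

(** A root of [1 + X + ... + X^(l-1)] is taken; it is not 1 because [l] is nonzero in [F]. *)
Lemma closed_prime_root (F : closedFieldType) l : prime l -> (l%:R : F) != 0 ->
  exists z : F, z ^+ l = 1 /\ z != 1.
Proof.
case: l => [|[|n]] // l_pr lF.
have [z hz] := @solve_monicpoly F n.+1 (fun _ => -1) isT.
have s0 : \sum_(i < n.+2) z ^+ i = 0.
  rewrite big_ord_recr /= {}hz.
  by rewrite -big_split big1 //= => i _; rewrite mulN1r subrr.
exists z; split.
  by apply/eqP; rewrite -subr_eq0 subrX1 s0 mulr0.
apply: contra_neq lF => z1; rewrite -s0 z1.
by under eq_bigr do rewrite expr1n; rewrite sumr_const card_ord.
Qed.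

(** For a Jacobi sum [x] with conjugate [y], the cube of the Gauss sum is [x ^+ 2 * y]. The two
    identities serve the two cases of [csym_jacobi], [q = 1] and [q = 2] modulo 3. *)
Lemma div_conj_cube (F : fieldType) (x y : F) : x != 0 -> y != 0 ->
  x ^+ 2 * y * (x / y) = x ^+ 3 /\ y / x * x ^+ 3 = x ^+ 2 * y.
Proof. by move=> x0 y0; split; field. Qed.

Lemma Fp_fermat l (x : 'F_l) : prime l -> x != 0 -> x ^+ l.-1 = 1.
Proof.
move=> l_pr x0; apply: (mulfI x0); rewrite mulr1 -exprS prednK ?prime_gt0 //.
by have := expf_card x; rewrite card_Fp.
Qed.

(** Here [l %/ 3] is [(l - 1) / 3], and a polynomial of that degree cannot vanish at all [l - 1]
    nonzero residues. *)
Lemma exists_noncube l : prime l -> (l %% 3 = 1)%N ->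
  exists2 x : 'F_l, x != 0 & x ^+ (l %/ 3) != 1.
Proof.
move=> l_pr l3; pose P : {poly 'F_l} := 'X^(l %/ 3) - 1.
have l1 := prime_gt1 l_pr.
have m0 : (0 < l %/ 3)%N by lia.
have P0 : P != 0 by rewrite -size_poly_eq0 size_XnsubC.
pose s := [seq x <- enum 'F_l | x != 0].
have us : uniq s by rewrite filter_uniq // enum_uniq.
have sz : size s = l.-1.
  have := cardC1 (0 : 'F_l); rewrite card_Fp // cardE => <-.
  rewrite /s /enum_mem -enumT -filter_predI; congr size.
  by apply: eq_filter => x; rewrite !inE andbT.
have /allPn[x xs Px] : ~~ all (root P) s.
  apply/negP => /max_poly_roots /(_ us); rewrite P0 sz size_XnsubC // => /(_ isT).
  by lia.
move: xs; rewrite mem_filter => /andP[x0 _]; exists x => //.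
by move: Px; rewrite rootE !hornerE subr_eq0.
Qed.

Section CubicCharacter.
Variables (l : nat).
Hypotheses (l_pr : prime l) (l3 : (l %% 3 = 1)%N).
Variable v : 'F_l.
Hypothesis v0 : v ^+ 2 + v + 1 = 0.

Let cl : l \in [pchar 'F_l] := pchar_Fp l_pr.

Fact Fl3 : (3%:R : 'F_l) != 0.
Proof.
rewrite (natr_eq0_char _ cl) dvdn_prime2 //; apply/eqP => l3'.
by move: l3; rewrite l3'.
Qed.

(** Exponent of the cubic residue character of ['F_l], with a junk value at 0. Choosing [v] amounts
    to choosing one of the two primes above [l]. *)
Definition cidx (x : 'F_l) : 'Z_3 :=
  if x ^+ (l %/ 3) == 1 then 0 else if x ^+ (l %/ 3) == v then 1 else 2%:R.

Lemma cidxE x : x != 0 -> x ^+ (l %/ 3) = v ^+ cidx x.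
Proof.
move=> x0; rewrite /cidx.
have y3 : (x ^+ (l %/ 3)) ^+ 3 = 1.
  rewrite -exprM; have -> : (l %/ 3 * 3 = l.-1)%N by lia.
  exact: Fp_fermat.
have [i ->] := cubed_eq1 v0 y3.
have inj := expZ3_inj v0 Fl3.
have h0 : (v ^+ i == 1) = (i == 0) by rewrite -(inj_eq inj i 0).
have h1 : (v ^+ i == v) = (i == 1) by rewrite -(inj_eq inj i 1).
by rewrite h0 h1; clear; case: i => [[|[|[|i]]] hi].
Qed.

Lemma cidxM x y : x != 0 -> y != 0 -> cidx (x * y) = cidx x + cidx y.
Proof.
move=> x0 y0; apply: (expZ3_inj v0 Fl3).
by rewrite /= (expZ3D v0) -!cidxE ?mulf_neq0 // exprMn.
Qed.

Lemma cidx1 : cidx 1 = 0.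
Proof. by rewrite /cidx expr1n eqxx. Qed.

Lemma cidxV x : x != 0 -> cidx x^-1 = - cidx x.
Proof.
move=> x0; apply/eqP; rewrite -addr_eq0 -cidxM ?invr_neq0 //.
by rewrite mulVf // cidx1.
Qed.

Lemma cidxN x : x != 0 -> cidx (- x) = cidx x.
Proof.
move=> x0; rewrite -mulN1r cidxM ?oppr_eq0 ?oner_eq0 //.
suff -> : cidx (-1) = 0 by rewrite add0r.
apply: double_Z3_eq0; rewrite -cidxM ?oppr_eq0 ?oner_eq0 //.
by rewrite mulrNN mulr1 cidx1.
Qed.

Lemma cidx_nontriv : exists2 x, x != 0 & cidx x != 0.
Proof.
have [x x0 xc] := exists_noncube l_pr l3; exists x => //.
by apply: contraNneq xc => c0; rewrite cidxE // c0.
Qed.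

(** Stored with integer coordinates so that one element can be evaluated both in [algC], where its
    norm is read off, and in [Fbar q], where its symbol is computed. At 0 and 1 the extended
    character contributes 0. *)
Definition jacobi : eis :=
  (\sum_(x | (x != 0) && (x != 1)) (Z3coord (cidx x + cidx (1 - x))).1,
   \sum_(x | (x != 0) && (x != 1)) (Z3coord (cidx x + cidx (1 - x))).2).

Lemma sum_cidx : \sum_(x | x != 0) cidx x = 0.
Proof.
apply: double_Z3_eq0; rewrite {2}(reindex_inj invr_inj) /=.
rewrite [X in _ + X](eq_bigl (fun x => x != 0)); last by move=> x; rewrite invr_eq0.
by rewrite -big_split big1 // => x x0; rewrite /= cidxV // subrr.
Qed.

(* Modulo 3, [w ^+ i = 1 + i (w - 1)], so the second coordinate of the Jacobi
   sum is congruent to the sum of all the exponents. *)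
Lemma jacobi_primary : (3 %| `|jacobi.2|)%N.
Proof.
have c3 : 3%N \in [pchar 'Z_3] by exact: (pchar_Fp (isT : prime 3)).
rewrite -(intr_eq0_char _ c3) /= rmorph_sum /=.
under eq_bigr do rewrite Z3coord2.
have s1 : \sum_(x | (x != 0) && (x != 1)) cidx x = 0.
  by have := sum_cidx; rewrite (bigD1 1) ?oner_eq0 //= cidx1 add0r.
rewrite big_split /= s1 add0r (reindex_inj (subrI 1)) /=.
apply/eqP; rewrite -[RHS]s1; apply: eq_big => x; last by rewrite subKr.
by rewrite subr_eq0 eq_sym andbC -{2}[1]subr0 (inj_eq (subrI 1)).
Qed.

Section Gauss.
Variables (F : fieldType) (z : F).
Hypotheses (zl : z ^+ l = 1) (z1 : z != 1).

Definition chi (w : F) (x : 'F_l) : F := if x == 0 then 0 else w ^+ cidx x.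
Definition psi (x : 'F_l) : F := z ^+ x.
Definition gauss w := \sum_x chi w x * psi x.

Lemma psi_nat n : psi n%:R = z ^+ n.
Proof. by rewrite /psi -[RHS](expr_mod _ zl) val_Fp_nat. Qed.

Lemma psiD x y : psi (x + y) = psi x * psi y.
Proof. by rewrite -{1}[x]natr_Zp -{1}[y]natr_Zp -natrD psi_nat exprD. Qed.

Lemma psi0 : psi 0 = 1.
Proof. by rewrite /psi expr0. Qed.

Lemma sum_psi a : \sum_x psi (x * a) = if a == 0 then l%:R else 0.
Proof.
case: eqP => [->|/eqP a0].
  under eq_bigr do rewrite mulr0 psi0.
  by rewrite sumr_const card_Fp.
rewrite -(reindex_inj (mulIf a0) (P := predT)) /=.
have: psi 1 * \sum_x psi x = \sum_x psi x.
  rewrite mulr_sumr [RHS](reindex_inj (addrI 1)).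
  by apply: eq_bigr => x _; rewrite psiD.
have -> : psi 1 = z by rewrite -[1 : 'F_l]/(1%:R) psi_nat expr1.
move/eqP; rewrite -subr_eq0 -[X in _ - X]mul1r -mulrBl mulf_eq0 subr_eq0.
by rewrite (negPf z1) => /eqP.
Qed.

Section CharacterW.
Variable w : F.
Hypotheses (w0 : w ^+ 2 + w + 1 = 0) (F3 : (3%:R : F) != 0).

Lemma chi0 : chi w 0 = 0. Proof. by rewrite /chi eqxx. Qed.

Lemma chiM x y : chi w (x * y) = chi w x * chi w y.
Proof.
rewrite /chi mulf_eq0; case: eqP => [|/eqP x0]; first by rewrite mul0r.
case: eqP => [|/eqP y0]; first by rewrite mulr0.
by rewrite /= cidxM // (expZ3D w0).
Qed.

Lemma chi_sqr x : chi (w ^+ 2) x = chi w x ^+ 2.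
Proof. by rewrite /chi; case: eqP; rewrite ?expr0n // exprAC. Qed.

Lemma chi_mul_conj x : x != 0 -> chi w x * chi (w ^+ 2) x = 1.
Proof.
move=> x0; rewrite /chi (negPf x0) -exprMn -exprS (cube_root3 w0).
by rewrite expr1n.
Qed.

Lemma chi1 : chi w 1 = 1. Proof. by rewrite /chi oner_eq0 cidx1. Qed.

Lemma chiN x : chi w (- x) = chi w x.
Proof. by rewrite /chi oppr_eq0; case: eqP => // /eqP x0; rewrite cidxN. Qed.

Lemma sum_chi : \sum_x chi w x = 0.
Proof.
have [y y0 cy] := cidx_nontriv.
have: chi w y * \sum_x chi w x = \sum_x chi w x.
  rewrite mulr_sumr [RHS](reindex_inj (mulfI y0)).
  by apply: eq_bigr => x _; rewrite chiM.
move/eqP; rewrite -subr_eq0 -[X in _ - X]mul1r -mulrBl mulf_eq0 subr_eq0.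
case/orP => /eqP // h; case/eqP: cy; apply: (expZ3_inj w0 F3).
by move: h; rewrite /chi (negPf y0).
Qed.

Lemma ev_jacobi : ev w jacobi = \sum_x chi w x * chi w (1 - x).
Proof.
rewrite (bigID (fun x => (x != 0) && (x != 1))) /= addrC big1; last first.
  move=> x; rewrite negb_and !negbK => /orP[]/eqP->.
    by rewrite chi0 mul0r.
  by rewrite subrr chi0 mulr0.
rewrite add0r /ev /= !rmorph_sum mulr_suml -big_split /=.
apply: eq_bigr => x /andP[x0 x1]; rewrite -/(ev w _) (ev_Z3coord _ w0).
by rewrite /chi (negPf x0) subr_eq0 eq_sym (negPf x1) (expZ3D w0).
Qed.

End CharacterW.

Section GaussSum.
Variable w : F.
Hypotheses (w0 : w ^+ 2 + w + 1 = 0) (F3 : (3%:R : F) != 0).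
Let w20 := cube_root_sqr w0.

(** Terms of the square are collected by the sum [y] of the two arguments. For [y = 0] they add up
    to a full character sum, which is 0; for [y] nonzero, scaling by [y] extracts [chi w y ^+ 2] and
    leaves the Jacobi sum. *)
Lemma gauss_sqr : gauss w ^+ 2 = ev w jacobi * gauss (w ^+ 2).
Proof.
rewrite expr2 {1}/gauss mulr_suml.
under eq_bigr => x _.
  rewrite /gauss (reindex_inj (addIr (- x))) mulr_sumr.
  under eq_bigr => y _ do rewrite mulrACA -psiD [x + _]addrC subrK.
  over.
rewrite exchange_big /= mulr_sumr; apply: eq_bigr => y _.
rewrite -mulr_suml mulrA; congr (_ * _).
have [->|y0] := eqVneq y 0.
  rewrite chi0 mulr0 -[RHS](sum_chi w20 F3); apply: eq_bigr => x _.
  by rewrite sub0r chiN // chi_sqr expr2.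
rewrite (reindex_inj (mulfI y0)) (ev_jacobi w0) mulr_suml; apply: eq_bigr => x _.
have -> : y - y * x = y * (1 - x) by ring.
by rewrite !chiM // chi_sqr; ring.
Qed.

(** Scaling the inner variable by [y] cancels the two characters of [y]. Summing over nonzero [y]
    then gives [l - 1] at [x = -1] and -1 elsewhere; the -1 terms disappear with the full character
    sum. *)
Lemma gauss_norm : gauss w * gauss (w ^+ 2) = l%:R.
Proof.
rewrite {2}/gauss mulr_sumr (bigD1 0) //= chi0 mul0r mulr0 add0r.
under eq_bigr => y y0.
  rewrite /gauss (reindex_inj (mulIf y0)) mulr_suml.
  under eq_bigr => x _.
    rewrite mulrACA -psiD chiM // -(mulrA (chi w x)) chi_mul_conj // mulr1.
    have -> : x * y + y = (x + 1) * y by ring.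
    rewrite mulrC.
    over.
  over.
rewrite exchange_big /=; under eq_bigr => x _.
  rewrite -mulr_suml.
  have -> : \sum_(y | y != 0) psi ((x + 1) * y) = (if x + 1 == 0 then l%:R else 0) - 1.
    rewrite -sum_psi [in RHS](bigD1 0) //= mul0r psi0 addrC addrK.
    by apply: eq_bigr => y _; rewrite mulrC.
  rewrite mulrC mulrBr mulr1.
  over.
rewrite sumrB (sum_chi w0 F3) subr0 (bigD1 (-1)) //= addNr eqxx chiN // chi1 mul1r.
by rewrite big1 ?addr0 // => x; rewrite -subr_eq0 opprK => /negPf->; rewrite mulr0.
Qed.

(** Source of reciprocity: in characteristic [q] the power can be taken termwise, which multiplies
    the argument of [psi] by [q]. Undoing this by a change of variable brings out the character of
    [q] modulo [l]. *)
Lemma gauss_frob q : q \in [pchar F] -> (q%:R : 'F_l) != 0 ->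
  gauss w ^+ q * (w ^+ q) ^+ cidx q%:R = gauss (w ^+ q).
Proof.
move=> cq q0; rewrite /gauss (frob_sum cq) mulr_suml [RHS](reindex_inj (mulfI q0)).
apply: eq_bigr => x _; rewrite exprMn.
have -> : psi x ^+ q = psi (q%:R * x).
  by rewrite -{2}[x]natr_Zp -natrM psi_nat mulnC exprM.
rewrite mulrAC; congr (_ * _); rewrite /chi mulf_eq0 (negPf q0) /=.
case: eqP => [_|/eqP x0].
  by rewrite expr0n gtn_eqF ?mul0r // prime_gt0 // (pcharf_prime cq).
have wq0 : (w ^+ q) ^+ 2 + w ^+ q + 1 = 0.
  have <- : (w ^+ 2 + w + 1) ^+ q = 0.
    by rewrite w0 expr0n gtn_eqF // prime_gt0 // (pcharf_prime cq).
  by rewrite !(frobD cq) expr1n exprAC.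
by rewrite cidxM // (expZ3D wq0) mulrC; congr (_ * _); exact: exprAC.
Qed.

End GaussSum.
End Gauss.

Lemma natF_neq0 q : prime q -> q != l -> (q%:R : 'F_l) != 0.
Proof. by move=> qP ql; rewrite (natr_eq0_char _ cl) dvdn_prime2 // eq_sym. Qed.

(** [gauss_sqr] for [w] and for its conjugate are multiplied together and [gauss_norm] is divided
    out. The computation takes place in characteristic 0 so that the integer can be recovered. *)
Lemma enorm_jacobi : enorm jacobi = l.
Proof.
have [w /eqP w0] := closed_cube_root algC.
have lC : (l%:R : algC) != 0 by rewrite pnatr_eq0 -lt0n prime_gt0.
have C3 : (3%:R : algC) != 0 by rewrite pnatr_eq0.
have [z [zl z1]] := closed_prime_root l_pr lC.
have gN := gauss_norm zl z1 w0 C3.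
have g1 := gauss_sqr zl w0 C3.
have w4 : (w ^+ 2) ^+ 2 = w by rewrite -exprM (exprD w 3 1) (cube_root3 w0) mul1r.
have g2 := gauss_sqr zl (cube_root_sqr w0) C3; rewrite w4 in g2.
have h : ev w jacobi * ev (w ^+ 2) jacobi * l%:R = l%:R * l%:R :> algC.
  rewrite -gN; transitivity ((ev w jacobi * gauss z (w ^+ 2)) *
    (ev (w ^+ 2) jacobi * gauss z w)); first by ring.
  by rewrite -g1 -g2; ring.
by apply/eqP; rewrite -(eqr_nat algC) -(ev_norm w0) -(inj_eq (mulIf lC)) h.
Qed.

(** Write [g] for the Gauss sum, [J] and [J'] for the evaluations, so [g ^+ 3 = J ^+ 2 * J']. If
    [q = 3 m + 1], [gauss_frob] gives the value of [g ^+ (3 * m)], while [J ^+ (3 * m) = 1]. If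
    [q = 3 m - 1], it gives [g ^+ (3 * m)] up to the factor [g * g' = J * J'], which is also
    [J ^+ (3 * m)]. Comparing [m]-th powers yields the symbol of [J]. *)
Lemma csym_jacobi q : prime q -> q != 3%N -> q != l -> csym q jacobi = cidx q%:R.
Proof.
move=> q_pr q3 ql; have cq := Fbar_char q_pr; have q0 := natF_neq0 q_pr ql.
set w := om q; have w0 : w ^+ 2 + w + 1 = 0 := om0 q.
have lF : (l%:R : Fbar q) != 0 by rewrite (natr_eq0_char _ cq) dvdn_prime2.
have F3 := Fbar3 q_pr q3.
have [z [zl z1]] := closed_prime_root l_pr lF.
have gN := gauss_norm zl z1 w0 F3.
have g1 := gauss_sqr zl w0 F3.
have gF := gauss_frob zl w0 cq q0.
have qj : ~~ (q %| enorm jacobi)%N by rewrite enorm_jacobi dvdn_prime2.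
have [n1 n2] := ev_norm_neq0 w0 cq qj.
have JN := ev_norm w0 jacobi; rewrite enorm_jacobi in JN.
have [g0 g0'] : gauss z w != 0 /\ gauss z (w ^+ 2) != 0.
  by apply/andP; rewrite -negb_or -mulf_eq0 gN.
have w3 := cube_root3 w0.
have g3 : gauss z w ^+ 3 = ev w jacobi ^+ 2 * ev (w ^+ 2) jacobi.
  by rewrite exprS g1 mulrCA gN -JN; ring.
apply: csym_uniq => //; rewrite -/w.
set m := ((q + 1) %/ 3)%N.
case: (prime_mod3 q_pr q3) => -[qE qm]; rewrite qm /= -/m in qE *.
  have wq : w ^+ q = w by rewrite -(expr_mod _ w3) qm.
  have qX (x : Fbar q) : x ^+ q = x ^+ (3 * m) * x.
    by rewrite -exprSr -addn1; congr (_ ^+ _).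
  move: gF; rewrite wq qX mulrAC -[RHS]mul1r => /(mulIf g0) gF.
  have : ev w jacobi ^+ q = ev w jacobi := ev_frob1 q_pr jacobi qm.
  rewrite qX -[RHS]mul1r => /(mulIf n1) EF.
  rewrite exprM g3 in gF.
  have n3 : (ev w jacobi ^+ 2 * ev (w ^+ 2) jacobi) ^+ m != 0.
    by rewrite expf_neq0 // mulf_neq0 // expf_neq0.
  apply: (mulfI n3); rewrite gF -exprMn -EF [in RHS]exprM; congr (_ ^+ _).
  exact: (proj1 (div_conj_cube n1 n2)).
have wq : w ^+ q = w ^+ 2 by rewrite -(expr_mod _ w3) qm.
have qS : q.+1 = (3 * m)%N by move: (prime_gt0 q_pr) qE; move: m => k; clear; lia.
have EF : ev w jacobi ^+ (3 * m) = ev w jacobi * ev (w ^+ 2) jacobi.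
  by rewrite -qS exprS (ev_frob2 q_pr).
move/(congr1 ( *%R (gauss z w))): gF.
rewrite wq mulrA -exprS qS exprM g3 gN -JN => gF.
apply: (mulIf (expf_neq0 (3 * m) n1)); rewrite [in LHS]exprM -exprMn EF -gF.
rewrite [RHS]mulrCA -[X in _ = _ * X]exprMn -exprS w3 expr1n mulr1; congr (_ ^+ _).
exact: (proj2 (div_conj_cube n1 n2)).
Qed.

End CubicCharacter.

(** * Reciprocity with rational integers *)

(** Reciprocity for a single [e]: the symbol, as a function of the modulus [q], comes from a cubic
    character modulo the norm. At 3 the symbol is meaningless, so [chi 3] is not tied to it. *)
Definition reciprocal (e : eis) (chi : nat -> 'Z_3) : Prop :=
  [/\ forall m n, coprime m (enorm e) -> coprime n (enorm e) ->
        chi (m * n)%N = chi m + chi n,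
      forall m n, m = n %[mod enorm e] -> chi m = chi n &
      forall q, prime q -> q != 3%N -> ~~ (q %| enorm e)%N -> csym q e = chi q].

(* Congruent modulo 3 to a rational integer prime to 3. *)
Definition primary (e : eis) : bool :=
  ((e.2%:~R : 'F_3) == 0) && ((e.1%:~R : 'F_3) != 0).

Lemma dvd3E n : (3 %| n)%N = ((n%:R : 'F_3) == 0).
Proof. by rewrite (natr_eq0_char _ (pchar_Fp (isT : prime 3))). Qed.

Lemma dvd3zE (n : int) : (3 %| `|n|)%N = ((n%:~R : 'F_3) == 0).
Proof. by rewrite (intr_eq0_char _ (pchar_Fp (isT : prime 3))). Qed.

Lemma enorm_nat e (R : nzRingType) : ((enorm e)%:R : R) = (enormz e)%:~R.
Proof. by rewrite -enormE. Qed.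

Lemma reciprocal_mul e f chi psi : reciprocal e chi -> reciprocal f psi ->
  reciprocal (emul e f) (fun n => chi n + psi n).
Proof.
move=> [e1 e2 e3] [f1 f2 f3]; split; rewrite enormM.
- move=> m n; rewrite !coprimeMr => /andP[me mf] /andP[ne nf].
  by rewrite e1 // f1 // addrACA.
- move=> m n mn; congr (_ + _).
    by apply: e2; move/(congr1 (modn^~ (enorm e))): mn; rewrite !modn_dvdm ?dvdn_mulr.
  by apply: f2; move/(congr1 (modn^~ (enorm f))): mn; rewrite !modn_dvdm ?dvdn_mull.
- move=> q q_pr q3 qef; rewrite csymM // ?enormM //.
  by move: qef; rewrite Euclid_dvdM // negb_or => /andP[qe qf]; rewrite e3 // f3.
Qed.

Lemma csym_rat q (n : int) : prime q -> q != 3%N -> ~~ (q %| `|n|)%N ->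
  csym q (n, 0) = 0.
Proof.
move=> q_pr q3 qn; have [] // := @csym_mod q q_pr q3 (n, 0) (1, 0) n.
- by rewrite /enorm /enormz /= dvdn1 neq_ltn prime_gt1 ?orbT.
- by rewrite /= mulr1 subrr dvdn0.
- by rewrite /= mulr0 subrr dvdn0.
by move=> _ ->; exact: csym1.
Qed.

Lemma reciprocal_rat (n : int) : reciprocal (n, 0) (fun=> 0).
Proof.
split=> // [m k _ _|q q_pr q3]; first by rewrite addr0.
have -> : enorm (n, 0) = (`|n| * `|n|)%N.
  by rewrite /enorm -abszM; congr absz; rewrite /enormz /=; ring.
by rewrite Euclid_dvdM // orbb; exact: csym_rat.
Qed.

Lemma enorm_conj e : enorm (econj e) = enorm e.
Proof. by rewrite /enorm enormz_conj. Qed.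

Lemma reciprocal_conj e chi : reciprocal e chi ->
  reciprocal (econj e) (fun n => - chi n).
Proof.
move=> [e1 e2 e3]; split; rewrite enorm_conj.
- by move=> m n hm hn; rewrite e1 // opprD.
- by move=> m n /e2->.
- by move=> q q_pr q3 qe; rewrite csym_conj // e3.
Qed.

Lemma prime1mod3_cube_root l : prime l -> (l %% 3 = 1)%N ->
  exists v : 'F_l, v ^+ 2 + v + 1 = 0.
Proof.
move=> l_pr l3; have [x x0 xc] := exists_noncube l_pr l3.
have y1 : x ^+ (l %/ 3) - 1 != 0 by rewrite subr_eq0.
exists (x ^+ (l %/ 3)); apply: (mulfI y1); rewrite mulr0.
set y := x ^+ _; transitivity (y ^+ 3 - 1); first by ring.
apply/eqP; rewrite subr_eq0 -exprM; apply/eqP.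
have -> : (l %/ 3 * 3 = l.-1)%N by lia.
exact: Fp_fermat.
Qed.

Lemma primary_norm e : primary e -> ~~ (3 %| enorm e)%N.
Proof.
case/andP=> /eqP e2 e1; rewrite dvd3E enorm_nat /enormz.
by rewrite !expr2 !(intrD, intrN, intrM) e2 !mulr0 oppr0 !addr0 mulf_neq0.
Qed.

Lemma primary_mulKl e f : primary e -> primary (emul e f) -> primary f.
Proof.
case/andP=> /eqP e2 e1 /andP[/=].
rewrite !(intrD, intrN, intrM) e2 !mul0r !oppr0 !addr0 !mulf_eq0 (negPf e1) /=.
by rewrite /primary => ->.
Qed.

Lemma primary_conj e : primary e -> primary (econj e).
Proof.
by case/andP=> /eqP e2 e1; rewrite /primary /= !(intrD, intrN) e2 oppr0 addr0 eqxx.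
Qed.

Lemma jacobi_is_primary l (l_pr : prime l) (l3 : (l %% 3 = 1)%N) (v : 'F_l)
  (v0 : v ^+ 2 + v + 1 = 0) : primary (jacobi v).
Proof.
have := jacobi_primary l_pr l3 v0; rewrite /primary dvd3zE => /eqP j2.
rewrite j2 eqxx /=; apply: contraTneq isT => j1.
have : (3 %| enorm (jacobi v))%N.
  rewrite dvd3E enorm_nat /enormz !expr2 !(intrD, intrN, intrM) j2 j1.
  by rewrite !mulr0 oppr0 !addr0.
by rewrite (enorm_jacobi l_pr l3 v0) /dvdn l3.
Qed.

Lemma reciprocal_jacobi l (l_pr : prime l) (l3 : (l %% 3 = 1)%N) (v : 'F_l)
  (v0 : v ^+ 2 + v + 1 = 0) : reciprocal (jacobi v) (fun n => cidx v n%:R).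
Proof.
have cl := pchar_Fp l_pr.
split; rewrite (enorm_jacobi l_pr l3 v0).
- move=> m n; rewrite coprime_sym prime_coprime // => lm.
  rewrite coprime_sym prime_coprime // => ln.
  by rewrite natrM cidxM // (natr_eq0_char _ cl).
- by move=> m n /eqP; rewrite -(natr_eq_char _ _ cl) => /eqP->.
- move=> q q_pr q3; rewrite dvdn_prime2 // => ql.
  exact: csym_jacobi.
Qed.

(** A norm divisible by [q] means vanishing at [w] or at [w ^+ 2]. Let [g] be whichever of [f] and
    its conjugate vanishes where [e] does; then [econj g] vanishes at the other point, and the
    product at both. *)
Lemma emul_conj_coprime q e f : prime q -> q != 3%N ->
  (q %| enorm e)%N -> (q %| enorm f)%N ->
  exists2 g, g = f \/ g = econj f &
    (q %| `|(emul e (econj g)).1|)%N /\ (q %| `|(emul e (econj g)).2|)%N.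
Proof.
move=> q_pr q3; have cq := Fbar_char q_pr; have w0 := om0 q.
have F3 := Fbar3 q_pr q3.
rewrite -!(natr_eq0_char _ cq) -!(ev_norm w0) !mulf_eq0.
have hw (x y : eis) : ev (om q) x * ev (om q) y = 0 ->
    ev (om q ^+ 2) x * ev (om q ^+ 2) y = 0 ->
    (q %| `|(emul x y).1|)%N /\ (q %| `|(emul x y).2|)%N.
  move=> h1 h2; apply: (ev_inj0 w0 cq F3); first by rewrite evM.
  by rewrite (evM (cube_root_sqr w0)).
have w4 : (om q ^+ 2) ^+ 2 = om q.
  by rewrite -exprM (exprD _ 3 1) (cube_root3 w0) mul1r.
have c2 x : ev (om q ^+ 2) (econj x) = ev (om q) x.
  by rewrite (ev_conj (cube_root_sqr w0)) w4.
case/orP=> /eqP e0 /orP[] /eqP f0.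
- by exists f; [left|apply: hw; rewrite ?e0 ?mul0r // c2 f0 mulr0].
- exists (econj f); first by right.
  by rewrite econjK; apply: hw; rewrite ?e0 ?mul0r // f0 mulr0.
- exists (econj f); first by right.
  by rewrite econjK; apply: hw; rewrite ?e0 ?mul0r // f0 mulr0.
- by exists f; [left|apply: hw; rewrite ?e0 ?mul0r // ev_conj // f0 mulr0].
Qed.

(** Such a [q] is inert: Frobenius exchanges the two evaluations, so if one vanishes both do. *)
Lemma dvd_eis_norm2 q e : prime q -> (q %% 3 = 2)%N -> (q %| enorm e)%N ->
  (q %| `|e.1|)%N /\ (q %| `|e.2|)%N.
Proof.
move=> q_pr q2; have cq := Fbar_char q_pr; have w0 := om0 q.
have q3 : q != 3%N by apply: contra_eqN q2 => /eqP->.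
rewrite -(natr_eq0_char _ cq) -(ev_norm w0) => ee.
have F3 := Fbar3 q_pr q3.
have q0 : q == 0%N = false by rewrite gtn_eqF ?prime_gt0.
have [e0|e0] : ev (om q) e = 0 \/ ev (om q ^+ 2) e = 0.
    by move: ee; rewrite mulf_eq0 => /orP[]/eqP; [left|right].
  apply: (ev_inj0 w0 cq F3 e0).
  by rewrite -(ev_frob2 q_pr e q2) e0 expr0n q0.
apply: (ev_inj0 w0 cq F3) (e0).
by rewrite -(ev_frob2' q_pr e q2) e0 expr0n q0.
Qed.

Lemma emul_ratl (n : int) e : emul (n, 0) e = (n * e.1, n * e.2).
Proof. by rewrite /emul /=; congr pair; ring. Qed.

Lemma enorm_rat (n : int) : enorm (n, 0) = (`|n| ^ 2)%N.
Proof. by rewrite /enorm -abszX; congr absz; rewrite /enormz /=; ring. Qed.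

Lemma dvd_eis q e : (q %| `|e.1|)%N -> (q %| `|e.2|)%N ->
  exists f, e = emul (q%:Z, 0) f.
Proof.
rewrite -[q]/(`|q%:Z|)%N => /intdiv.dvdzP[a ea] /intdiv.dvdzP[b eb].
exists (a, b); rewrite emul_ratl /= mulrC [_ * b]mulrC -ea -eb.
by case: (e).
Qed.

(** Stands in for prime factorisation. The factor is [q] itself when [q] divides both coordinates,
    as it must when [q = 2 mod 3]; otherwise it is a Jacobi sum of norm [q], or its conjugate. *)
Lemma primary_factor q e : prime q -> (q %| enorm e)%N -> primary e ->
  exists f g chi, [/\ e = emul f g, (q %| enorm f)%N, primary f & reciprocal f chi].
Proof.
move=> q_pr qe pe; have N3 := primary_norm pe.
have q3 : q != 3%N by apply: contraNneq N3 => <-.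
have prat : primary (q%:Z, 0).
  by rewrite /primary -!dvd3zE dvdn0 dvdn_prime2 // eq_sym.
have split_rat : (q %| `|e.1|)%N -> (q %| `|e.2|)%N ->
  exists f g chi, [/\ e = emul f g, (q %| enorm f)%N, primary f & reciprocal f chi].
  move=> h1 h2; have [g eg] := dvd_eis h1 h2.
  exists (q%:Z, 0), g, (fun=> 0); split=> //; last exact: reciprocal_rat.
  by rewrite enorm_rat expnS dvdn_mulr.
case: (prime_mod3 q_pr q3) => -[_ qm]; last first.
  by have [h1 h2] := dvd_eis_norm2 q_pr qm qe; apply: split_rat.
have [v v0] := prime1mod3_cube_root q_pr qm.
have nJ := enorm_jacobi q_pr qm v0.
have qJ : (q %| enorm (jacobi v))%N by rewrite nJ.
have [g gJ [h1 h2]] := emul_conj_coprime q_pr q3 qe qJ.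
have [pg ng [chi rg]] : [/\ primary g, enorm g = q & exists chi, reciprocal g chi].
  have pJ := jacobi_is_primary q_pr qm v0.
  have rJ := reciprocal_jacobi q_pr qm v0.
  case: gJ => ->; split; rewrite ?enorm_conj ?primary_conj //.
    by exists (fun n => cidx v n%:R).
  by exists (fun n => - cidx v n%:R); apply: reciprocal_conj.
have [h eh] := dvd_eis h1 h2.
exists g, h, chi; split; rewrite ?ng //.
have gz : enormz g = q%:Z by rewrite -enormE ng.
have q0 : q%:Z != 0 by rewrite -lt0n prime_gt0.
(* Multiplying [emul e (econj g) = q h] by [g], whose norm is [q], gives [q e = q (g h)], and [q]
   cancels. *)
have := congr1 (emul g) eh.
have -> : emul g (emul e (econj g)) = (q%:Z * e.1, q%:Z * e.2).
  by rewrite -gz /emul /econj /enormz /=; congr pair; ring.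
have -> : emul g (emul (q%:Z, 0) h) = (q%:Z * (emul g h).1, q%:Z * (emul g h).2).
  by rewrite /emul /=; congr pair; ring.
by case=> /(mulfI q0) e1 /(mulfI q0) e2; case: (e) e1 e2 => a b /= -> ->.
Qed.

(** Strong induction on the norm, removing one factor at a time. In norm 1, a second coordinate
    divisible by 3 must be 0, so the element is rational. *)
Theorem primary_reciprocal e : primary e -> exists chi, reciprocal e chi.
Proof.
have [n] := ubnP (enorm e); elim: n e => // n IHn e; rewrite ltnS => le_n pe.
have N3 := primary_norm pe.
have [N1|N1] := eqVneq (enorm e) 1%N.
  suff e2 : e.2 = 0.
    by exists (fun=> 0); case: (e) e2 => a b /= ->; apply: reciprocal_rat.
  have [k ek] : exists k : int, e.2 = 3%:Z * k.
    move: pe => /andP[]; rewrite -dvd3zE => /(@intdiv.dvdzP 3%:Z)[k ->] _.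
    by exists k; rewrite mulrC.
  have := enormE e; rewrite N1 /enormz ek => Ne.
  suff -> : k = 0 by rewrite mulr0.
  clear -Ne; nia.
have [] := primary_factor (pdiv_prime _) (pdiv_dvd _) pe.
  by clear -N1 N3; move: (enorm e) N1 N3 => [|[|m]].
move=> f [g [chi [eE qf pf rf]]]; 
have pg : primary g by move: (pe); rewrite eE; exact: primary_mulKl.
have Ngt0 : (0 < enorm g)%N.
  by rewrite lt0n; apply: contraNneq (primary_norm pg) => ->.
have Nf1 : (1 < enorm f)%N.
  have pp : prime (pdiv (enorm e)).
    by apply: pdiv_prime; clear -N1 N3; move: (enorm e) N1 N3 => [|[|m]].
  have Nf0 : (0 < enorm f)%N.
    by rewrite lt0n; apply: contraNneq (primary_norm pf) => ->.
  exact: leq_trans (prime_gt1 pp) (dvdn_leq Nf0 qf).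
have lt_g : (enorm g < n)%N.
  apply: leq_trans le_n; rewrite [in X in (_ <= X)%N]eE enormM.
  by rewrite -[X in (X < _)%N]mul1n ltn_pmul2r.
have [psi rg] := IHn g lt_g pg.
exists (fun n => chi n + psi n); rewrite eE; exact: reciprocal_mul.
Qed.

(** * The symbol of (A + 3 B sqrt(-3)) / 2 *)

(** The modulus is freed from the norm, since the unit [w] contributes a character modulo 9. *)
Definition char3 (M : nat) (chi : nat -> 'Z_3) : Prop :=
  (forall m n, coprime m M -> coprime n M -> chi (m * n)%N = chi m + chi n) /\
  (forall m n, m = n %[mod M] -> chi m = chi n).

Section Char3.
Variables (M : nat) (chi : nat -> 'Z_3).
Hypothesis chiP : char3 M chi.

Lemma char3_1 : chi 1%N = 0.
Proof.
have := chiP.1 1%N 1%N (coprime1n _) (coprime1n _).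
by rewrite muln1 => /eqP; rewrite -subr_eq subrr => /eqP.
Qed.

Lemma char3X n k : coprime n M -> chi (n ^ k)%N = chi n *+ k.
Proof.
move=> cn; elim: k => [|k IHk]; first by rewrite char3_1.
by rewrite expnS chiP.1 ?coprimeXl // IHk mulrS.
Qed.

(** [M.-1] stands for -1. Its square is 1, so a cubic character is trivial on it and cannot tell [n]
    from [- n]. *)
Lemma char3_opp m n : (0 < M)%N -> (M %| m + n)%N -> coprime n M -> chi m = chi n.
Proof.
move=> M0 mn cn.
have cM : coprime M.-1 M by case: (M) M0 => // k _; exact: coprimenS.
have chiM : chi M.-1 = 0.
  apply: double_Z3_eq0; rewrite -chiP.1 // -char3_1; apply: chiP.2.
  case: (M) M0 => [//|[|k]] _ /=; first by rewrite !modn1.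
  have -> : (k.+1 * k.+1 = k * k.+2 + 1)%N by lia.
  by rewrite modnMDl.
have -> : chi m = chi (M.-1 * n)%N.
  apply/chiP.2/eqP; rewrite -(eqn_modDr n) -mulSnr prednK // modnMr.
  by move: mn; rewrite /dvdn.
by rewrite chiP.1 // chiM add0r.
Qed.

(** Applied to [A] or [B], whose prime divisors [q] are exactly those modulo which the symbol
    becomes explicit. *)
Lemma char3_primes n : (0 < n)%N -> coprime n M ->
  (forall q, prime q -> (q %| n)%N -> chi q = 0) -> chi n = 0.
Proof.
have [k] := ubnP n; elim: k n => // k IHk n; rewrite ltnS => le_nk n0 cn hn.
have [->|n1] := eqVneq n 1%N; first exact: char3_1.
have n2 : (1 < n)%N by case: (n) n0 n1 => [|[]].
have pq := pdiv_prime n2; have qn := pdiv_dvd n.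
have nE := divnK qn; move: (cn); rewrite -nE coprimeMl => /andP[c1 c2].
rewrite chiP.1 // (hn _ pq qn) addr0; apply: IHk => //.
- by apply: leq_trans le_nk; rewrite ltn_Pdiv // prime_gt1.
- by rewrite divn_gt0 ?prime_gt0 // dvdn_leq.
- by move=> q q_pr qd; apply: hn => //; apply: dvdn_trans qd (dvdn_div qn).
Qed.

End Char3.

Lemma reciprocal_char3 e chi : reciprocal e chi -> char3 (enorm e) chi.
Proof. by case. Qed.

(** The supplementary law for [w], with [n] first reduced modulo 9: away from multiples of 3,
    [(n ^ 2 - 1) / 3] modulo 3 depends on nothing more. *)
Definition symw (n : nat) : 'Z_3 := (((n %% 9) ^ 2 - 1) %/ 3)%:R.

Lemma Z3_nat_eq m n : m = n %[mod 3] -> m%:R = n%:R :> 'Z_3.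
Proof. by move=> mn; apply/val_inj; rewrite /= !val_Zp_nat. Qed.

Lemma symw_char3 M : (9 %| M)%N -> char3 M symw.
Proof.
move=> M9; split=> [m n cm cn|m n mn]; last first.
  rewrite /symw; have -> // : (m = n %[mod 9])%N.
  by move/(congr1 (modn^~ 9)): mn; rewrite !modn_dvdm.
have c9 k : coprime k M -> coprime (k %% 9) 9.
  by rewrite coprime_modl; case/dvdnP: M9 => j ->; rewrite coprimeMr => /andP[].
move: (c9 _ cm) (c9 _ cn); rewrite /symw -modnMm.
move: (m %% 9)%N (ltn_pmod m (isT : 0 < 9)%N) (n %% 9)%N (ltn_pmod n (isT : 0 < 9)%N).
by do 9?[case=> [_|] //]; do 9?[case=> [_|] //] => *; apply: val_inj.
Qed.

Lemma csym_symw q : prime q -> q != 3%N -> csym q (0, 1) = symw q.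
Proof.
move=> q_pr q3; rewrite csym_om // /symw; apply: Z3_nat_eq.
have : ~~ (3 %| q)%N by rewrite dvdn_prime2 // eq_sym.
rewrite {2}(divn_eq q 9) [in RHS](divn_eq q 9) [in X in ~~ X](divn_eq q 9).
rewrite modnMDl modn_mod; move: (q %/ 9)%N (q %% 9)%N => a [|b] hb.
  by move: hb; rewrite addn0 mulnC dvdn_mulr.
have -> : ((a * 9 + b.+1) ^ 2 - 1 =
  ((9 * a ^ 2 + 2 * a * b.+1) * 3) * 3 + (b.+1 ^ 2 - 1))%N by nia.
by rewrite divnMDl // modnMDl.
Qed.

Lemma enorm_om : enorm (0, 1) = 1%N. Proof. by []. Qed.

(** One of [e], [w e], [w^2 e] is primary, by inspection of the residues modulo 3. The pairs tried
    are these three multiples, whence the exponents 0, 2, 1. *)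
Lemma primary_assoc e : ~~ (3 %| enorm e)%N ->
  exists j f, primary f /\ e = iter j (emul (0, 1)) f.
Proof.
rewrite dvd3E enorm_nat /enormz !expr2 !(intrD, intrN, intrM) => N3.
have : [|| primary e, primary (- e.2, e.1 - e.2) | primary (e.2 - e.1, - e.1)].
  rewrite /primary /= !(intrD, intrN); move: N3.
  move: (e.1%:~R : 'F_3) (e.2%:~R : 'F_3).
  by move=> [[|[|[|?]]] ?] [[|[|[|?]]] ?].
case/or3P => pf.
- by exists 0%N, e.
- exists 2%N, (- e.2, e.1 - e.2); split=> //.
  by case: (e) => a b; rewrite /= /emul /=; congr pair; ring.
- exists 1%N, (e.2 - e.1, - e.1); split=> //.
  by case: (e) => a b; rewrite /= /emul /=; congr pair; ring.
Qed.

Lemma enorm_iter_om j e : enorm (iter j (emul (0, 1)) e) = enorm e.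
Proof. by elim: j => //= j IHj; rewrite enormM enorm_om mul1n IHj. Qed.

Lemma csym_iter_om q j e : prime q -> q != 3%N -> ~~ (q %| enorm e)%N ->
  csym q (iter j (emul (0, 1)) e) = symw q *+ j + csym q e.
Proof.
move=> q_pr q3 qe; elim: j => [|j IHj]; first by rewrite mulr0n add0r.
rewrite iterS csymM //; last by rewrite -iterS enorm_iter_om.
by rewrite IHj csym_symw // mulrS addrA.
Qed.

(** If 3 divides the norm, sqrt(-3) divides [e], and only once because 3 does not divide [e.2]. Its
    symbol is trivial, and the quotient is a power of [w] times a primary element. *)
Lemma eis_char3 e : (enorm e != 0)%N -> (e.2%:~R : 'F_3) != 0 ->
  exists M chi, [/\ (0 < M)%N, (M %| 9 * enorm e)%N, char3 M chi &
    forall q, prime q -> q != 3%N -> ~~ (q %| enorm e)%N -> csym q e = chi q].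
Proof.
move=> N0 b3.
have unit_case f : (enorm f != 0)%N -> ~~ (3 %| enorm f)%N ->
  exists chi, char3 (9 * enorm f) chi /\
    forall q, prime q -> q != 3%N -> ~~ (q %| enorm f)%N -> csym q f = chi q.
  move=> Nf0 /primary_assoc[j [g [pg ->]]]; rewrite enorm_iter_om.
  have [chi rg] := primary_reciprocal pg; have [g1 g2 g3] := rg.
  have [w1 w2] := symw_char3 (dvdn_mulr (enorm g) (dvdnn 9)).
  exists (fun n => symw n *+ j + chi n); split.
    split=> [m n cm cn|m n mn].
      rewrite w1 // g1; first by rewrite mulrnDl addrACA.
        by move: cm; rewrite coprimeMr => /andP[].
      by move: cn; rewrite coprimeMr => /andP[].
    rewrite (w2 _ _ mn) (g2 m n) //.
    by move/(congr1 (modn^~ (enorm g))): mn; rewrite !modn_dvdm ?dvdn_mull.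
  by move=> q q_pr q3 qg; rewrite csym_iter_om // g3.
have [N3|N3] := boolP (3 %| enorm e)%N; last first.
  have [chi [c1 c2]] := unit_case e N0 N3.
  by exists (9 * enorm e)%N, chi; split; rewrite ?muln_gt0 ?lt0n ?dvdnn.
(* Modulo 3 the norm is the square of [e.1 + e.2]. *)
have [k ek] : exists k : int, e.1 + e.2 = 3%:Z * k.
  have : (3 %| `|(e.1 + e.2)%R|)%N.
    rewrite dvd3zE intrD; move: N3.
    rewrite dvd3E enorm_nat /enormz !expr2 !(intrD, intrN, intrM).
    move: (e.1%:~R : 'F_3) (e.2%:~R : 'F_3).
    by move=> [[|[|[|?]]] ?] [[|[|[|?]]] ?].
  by move=> /(@intdiv.dvdzP 3%:Z)[k ->]; exists k; rewrite mulrC.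
(* The quotient of [e] by [1 + 2 w], obtained by solving for the coordinates. *)
pose f : eis := (e.2 - k, e.2 - 2%:Z * k).
have eE : e = emul (1, 2%:R) f.
  case: (e) @f ek => a b; rewrite /= => ek; rewrite /emul /=.
  have -> : a = 3%:Z * k - b by rewrite -ek; ring.
  by congr pair; ring.
have NE : enorm e = (3 * enorm f)%N by rewrite eE enormM.
have Nf3 : ~~ (3 %| enorm f)%N.
  rewrite dvd3E enorm_nat /enormz /f /=.
  have -> : (e.2 - k) ^+ 2 - (e.2 - k) * (e.2 - 2%:Z * k) + (e.2 - 2%:Z * k) ^+ 2
    = e.2 * e.2 + 3%:Z * (k ^+ 2 - e.2 * k) by ring.
  rewrite intrD !intrM.
  have -> : (3%:Z%:~R : 'F_3) = 0 by apply/eqP; rewrite -dvd3zE.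
  by rewrite mul0r addr0 mulf_neq0.
have Nf0 : (enorm f != 0)%N by apply: contraNneq N0 => f0; rewrite NE f0.
have [chi [c1 c2]] := unit_case f Nf0 Nf3.
exists (9 * enorm f)%N, chi; split; rewrite ?muln_gt0 ?lt0n //.
  by rewrite NE mulnCA dvdn_mull.
move=> q q_pr q3; rewrite {2}eE NE Euclid_dvdM // negb_or => /andP[q3' qf].
rewrite csymM //; last by rewrite enormM Euclid_dvdM // negb_or q3'.
by rewrite csym_s3 // add0r c2.
Qed.

(* With A = 2 h - 3 B one has 4 n = A^2 + 23 B^2 and (h, 3 B) stands for
   (A + 3 B sqrt(-3)) / 2, whose norm is n + B^2. *)
Theorem char3_norm_form (n : nat) (h B : int) :
  n%:Z = h ^+ 2 - 3%:Z * h * B + 8%:Z * B ^+ 2 -> ~~ (3 %| n)%N -> coprime n `|B| ->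
  exists M chi, [/\ char3 M chi, coprime n M, chi n = 0 &
    forall q, prime q -> (q %| n)%N -> csym q (h, 3%:Z * B) = chi q].
Proof.
move=> nE n3 cnB.
have n0 : (0 < n)%N by case: (n) n3.
have n3q q : (q %| n)%N -> q != 3%N by apply: contraTneq => ->.
have F30 : (3%:Z%:~R : 'F_3) = 0 by apply/eqP; rewrite -dvd3zE.
(* Only primes other than 3 can be handled by reciprocity. If 3 divides [B], then [mu] is primary
   and [A] is prime to 3; otherwise 3 divides [h], hence [A], so [B] is used with [mu / 3]. *)
have [B3|B3] := boolP ((B%:~R : 'F_3) == 0).
  pose mu : eis := (h, 3%:Z * B).
  have h3 : (h%:~R : 'F_3) != 0.
    apply: contraNneq n3 => h3; rewrite dvd3E -[n%:R]/(n%:Z%:~R) nE.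
    by rewrite !expr2 !(intrD, intrN, intrM) h3 (eqP B3) !(mulr0, oppr0, addr0).
  have pmu : primary mu by rewrite /primary /= intrM F30 mul0r eqxx.
  have N3 := primary_norm pmu.
  have [chi rmu] := primary_reciprocal pmu; have cmu := reciprocal_char3 rmu.
  have [_ _ c3] := rmu.
  have NE : enorm mu = (n + `|B| ^ 2)%N.
    have : (enorm mu)%:Z = n%:Z + (`|B| ^ 2)%N%:Z.
      by rewrite enormE nE -abszX gez0_abs ?sqr_ge0 // /mu /enormz /=; ring.
    by rewrite -PoszD => -[].
  have cnN : coprime n (enorm mu) by rewrite NE /coprime gcdnDl; exact: coprimeXr.
  have qN q : prime q -> (q %| n)%N -> ~~ (q %| enorm mu)%N.
    move=> q_pr qn; rewrite -prime_coprime //.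
    exact: coprime_dvdl qn cnN.
  exists (enorm mu), chi; split=> //; last first.
    by move=> q q_pr qn; apply: c3; rewrite ?n3q ?qN.
  pose A := 2%:Z * h - 3%:Z * B; pose a := `|A|%N.
  (* From [4 n = A^2 + 23 B^2] and norm [n + B^2]. Eliminating [B] makes [27 n] a square modulo the
     norm. *)
  have aE : (27 * n = 23 * enorm mu + a ^ 2)%N.
    have : 27%:Z * n%:Z = 23%:Z * (enorm mu)%:Z + (a ^ 2)%N%:Z.
      by rewrite enormE nE -abszX gez0_abs ?sqr_ge0 // /A /mu /enormz /=; ring.
    by rewrite -!PoszM -PoszD => -[].
  have a27 : (27 * n = a ^ 2 %[mod enorm mu])%N by rewrite aE modnMDl.
  have c27 : coprime 27 (enorm mu).
    by rewrite (@coprimeXl 3 3) // prime_coprime.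
  have c3N : coprime 3 (enorm mu) by rewrite prime_coprime.
  have caN : coprime a (enorm mu).
    rewrite -(@coprime_pexpl 2) // -coprime_modl -a27 coprime_modl.
    by rewrite coprimeMl c27.
  have a0 : (0 < a)%N.
    rewrite lt0n; apply: contraNneq N3 => a0.
    have : (27 %| 23 * enorm mu)%N.
      by apply/dvdnP; exists n; rewrite [RHS]mulnC aE a0 addn0.
    by rewrite Gauss_dvdr // => /(dvdn_trans (isT : 3 %| 27)%N).
  have ca0 : chi a = 0.
    apply: (char3_primes cmu) => // q q_pr qa.
    have q3 : q != 3%N.
      apply: contraTneq qa => ->; rewrite -[a]/(`|A|%N) dvd3zE /A !(intrD, intrN, intrM).
      rewrite F30 mul0r oppr0 addr0 mulf_neq0 //.
    have qN' : ~~ (q %| enorm mu)%N by rewrite -prime_coprime //; exact: coprime_dvdl qa caN.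
    rewrite -c3 //.
    have qh : ~~ (q %| `|h|)%N.
      apply: contra qN' => qh.
      rewrite -(natr_eq0_char _ (Fbar_char q_pr)) enorm_nat /enormz /=.
      have h0 : (h%:~R : Fbar q) = 0 by apply/eqP; rewrite (intr_eq0_char _ (Fbar_char q_pr)).
      have : ((2%:Z * h - 3%:Z * B)%:~R : Fbar q) == 0 by rewrite (intr_eq0_char _ (Fbar_char q_pr)).
      rewrite intrB !intrM h0 mulr0 sub0r oppr_eq0 => /eqP B0.
      by rewrite !(rmorphD, rmorphN, rmorphXn, rmorphM) /= h0 B0 !(mul0r, mulr0, expr0n, addr0, oppr0).
    (* Modulo a prime divisor of [A], [3 B = 2 h], so [mu] is [h] times sqrt(-3). *)
    have [] // := @csym_mod q q_pr q3 mu (1, 2%:R) h.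
    + by rewrite /enorm /enormz /= dvdn_prime2.
    + by rewrite /= mulr1 subrr dvdn0.
    + rewrite /mu /=; have -> : 3%:Z * B - h * 2%:R = - A by rewrite /A; ring.
      by rewrite abszN.
    + by move=> _ ->; exact: csym_s3.
  have : chi (27 * n)%N = chi (a ^ 2)%N by apply: cmu.2.
  rewrite cmu.1 // (@char3X _ _ cmu a 2) // ca0 mul0rn.
  (* 27 is a cube, so its character vanishes whatever [chi 3] is. *)
  rewrite -[27%N]/(3 ^ 3)%N (char3X cmu) // => <-.
  suff -> : chi 3%N *+ 3 = 0 by rewrite add0r.
  by case: (chi 3%N) => [[|[|[|?]]] ?] //; apply: val_inj.
have [k hk] : exists k : int, h = 3%:Z * k.
  have : (3 %| `|h|)%N.
    move: n3; rewrite dvd3E -[n%:R]/(n%:Z%:~R) nE !expr2 !(intrD, intrN, intrM) F30.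
    have -> : (8%:Z%:~R : 'F_3) = -1 by apply: val_inj.
    rewrite dvd3zE; move: (h%:~R : 'F_3) (B%:~R : 'F_3) B3.
    by move=> [[|[|[|?]]] ?] [[|[|[|?]]] ?].
  by move=> /(@intdiv.dvdzP 3%:Z)[k ->]; exists k; rewrite mulrC.
(* This is [mu / 3]; the rational factor 3 does not change the symbol. *)
pose nu : eis := (k, B).
have NE : (9 * enorm nu = n + `|B| ^ 2)%N.
  have : 9%:Z * (enorm nu)%:Z = n%:Z + (`|B| ^ 2)%N%:Z.
    by rewrite enormE nE hk -abszX gez0_abs ?sqr_ge0 // /nu /enormz /=; ring.
  by rewrite -!PoszM -PoszD => -[].
have cnN : coprime n (9 * enorm nu) by rewrite NE /coprime gcdnDl; exact: coprimeXr.
have N0 : (enorm nu != 0)%N by apply: contraNneq B3 => N0; move: NE; rewrite N0; case: (n) n0.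
have [M [chi [M0 MN cM c3]]] := @eis_char3 nu N0 B3.
have cnM : coprime n M := coprime_dvdr MN cnN.
have qN q : prime q -> (q %| n)%N -> ~~ (q %| enorm nu)%N.
  move=> q_pr qn; rewrite -prime_coprime //.
  by apply: (coprime_dvdl qn); move: cnN; rewrite coprimeMr => /andP[].
exists M, chi; split=> //; last first.
  move=> q q_pr qn; have q3 := n3q q qn; have qNn := qN q q_pr qn.
  have [] // := @csym_mod q q_pr q3 (h, 3%:Z * B) nu 3%:Z.
  - by rewrite dvdn_prime2.
  - by rewrite hk subrr dvdn0.
  - by rewrite subrr dvdn0.
  by move=> _ ->; rewrite c3.
pose b := `|B|%N.
have cbN : coprime b (9 * enorm nu).
  rewrite -(@coprime_pexpl 2) // NE /coprime gcdnDr -/(coprime _ _).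
  by rewrite coprime_sym; exact: coprimeXr.
have cbM : coprime b M := coprime_dvdr MN cbN.
have b0 : (0 < b)%N by rewrite lt0n; apply: contraNneq B3; rewrite /b => /eqP; rewrite absz_eq0 => /eqP->.
have cb0 : chi b = 0.
  apply: (char3_primes cM) => // q q_pr qb.
  have q3 : q != 3%N by apply: contraTneq qb => ->; rewrite /b dvd3zE.
  have qN' : ~~ (q %| enorm nu)%N.
    rewrite -prime_coprime //; apply: (coprime_dvdl qb).
    by move: cbN; rewrite coprimeMr => /andP[].
  rewrite -c3 //.
  have qk : ~~ (q %| `|k|)%N.
    apply: contra qN' => qk.
    rewrite -(natr_eq0_char _ (Fbar_char q_pr)) enorm_nat /enormz /=.
    have k0 : (k%:~R : Fbar q) = 0 by apply/eqP; rewrite (intr_eq0_char _ (Fbar_char q_pr)).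
    have B0 : (B%:~R : Fbar q) = 0 by apply/eqP; rewrite (intr_eq0_char _ (Fbar_char q_pr)).
    by rewrite !expr2 !(intrD, intrN, intrM) k0 B0 !(mul0r, mulr0, addr0, oppr0).
  (* Modulo a prime divisor of [B], [nu] is the rational integer [k]. *)
  have [] // := @csym_mod q q_pr q3 nu (1, 0) k.
  + by rewrite /enorm /enormz /= dvdn1 neq_ltn prime_gt1 ?orbT.
  + by rewrite /= mulr1 subrr dvdn0.
  + by rewrite /nu /= mulr0 subr0.
  + by move=> _ ->; exact: csym1.
(* [n + B^2] is 9 times the norm of [nu], a multiple of [M], so [n] is [- B^2] modulo [M]. *)
rewrite (@char3_opp _ _ cM n (b ^ 2)) ?coprimeXl //.
  by rewrite (char3X cM) // cb0 mul0rn.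
by rewrite -NE.
Qed.

Lemma prime_principal_ndvd p (X Y : int) : prime p ->
  p%:Z = X ^+ 2 + 23%:Z * Y ^+ 2 -> ~~ (p %| `|Y|)%N.
Proof.
move=> p_pr pE.
have pE' : (p = `|X| ^ 2 + 23 * `|Y| ^ 2)%N.
  by apply/eqP; rewrite -eqz_nat pE PoszD PoszM -!abszX !gez0_abs ?sqr_ge0.
apply/negP => pY; have [Y0|Y0] := posnP `|Y|%N.
  move: pE'; rewrite Y0 muln0 addn0 => pE'.
  have pX : (p %| `|X|)%N by have := dvdnn p; rewrite {2}pE' Euclid_dvdX // => /andP[].
  have X0 : (0 < `|X|)%N by case: (`|X|%N) pE' (prime_gt0 p_pr) => // ->.
  have := dvdn_leq X0 pX; have := prime_gt1 p_pr; clear -pE'; nia.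
have := dvdn_leq Y0 pY; have := prime_gt0 p_pr; clear -pE'; nia.
Qed.

Lemma prime_nonprincipal_ndvd p (x y : int) : prime p -> p != 2%N ->
  p%:Z = 2%:Z * x ^+ 2 + x * y + 3%:Z * y ^+ 2 ->
  ~~ (2 %| `|y|)%N /\ ~~ (p %| `|y|)%N.
Proof.
move=> p_pr p2 pE.
have p_odd : odd p by case: (even_prime p_pr) => // /eqP; rewrite (negPf p2).
have y_odd : ~~ (2 %| `|y|)%N.
  apply/negP => /(@intdiv.dvdzP 2%:Z)[k yE].
  have : (2 %| `|p%:Z|)%N.
    apply/(@intdiv.dvdzP 2%:Z); exists (x ^+ 2 + x * k + 6%:Z * k ^+ 2).
    by rewrite pE yE; ring.
  by rewrite /= dvdn2 p_odd.
split=> //.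
have y2 : y ^+ 2 = (`|y| ^ 2)%N%:Z by rewrite -abszX gez0_abs ?sqr_ge0.
apply/negP => py; have y0 : (0 < `|y|)%N.
  by rewrite lt0n; apply: contraNneq y_odd => ->.
have le_py := dvdn_leq y0 py.
(* [8 p = (4 x + y)^2 + 23 y^2]. *)
have : 23%:Z * (`|y| ^ 2)%N%:Z <= 8%:Z * p%:Z.
  rewrite pE -y2; have := sqr_ge0 (4%:Z * x + y); clear; nia.
have := prime_gt0 p_pr; clear -le_py; nia.
Qed.

(** [4 p = A^2 + 23 B^2] with [A = 2 X] and [B = 2 Y], so [h = (A + 3 B) / 2] is [X + 3 Y]. *)
Theorem csym_principal p (X Y : int) : prime p -> p != 2%N -> p != 3%N ->
  p%:Z = X ^+ 2 + 23%:Z * Y ^+ 2 -> csym p (X + 3%:Z * Y, 6%:Z * Y) = 0.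
Proof.
move=> p_pr p2 p3 pE.
have pY := prime_principal_ndvd p_pr pE.
have n3 : ~~ (3 %| p)%N by rewrite dvdn_prime2 // eq_sym.
have cpB : coprime p `|(2%:Z * Y)%R|%N.
  by rewrite prime_coprime // abszM Euclid_dvdM // negb_or pY dvdn_prime2 // p2.
have [|M [chi [_ _ chip cs]]] := @char3_norm_form p (X + 3%:Z * Y) (2%:Z * Y) _ n3 cpB.
  by rewrite pE; ring.
rewrite -chip -cs ?dvdnn //; congr (csym _ (_, _)); ring.
Qed.

(** [8 p = A^2 + 23 B^2] with [A = 4 x + y] and [B = y], so [h = 2 (x + y)]. The character is
    trivial at [2 p], hence opposite at 2 and at [p]. *)
Theorem csym_nonprincipal p (x y : int) : prime p -> p != 2%N -> p != 3%N ->
  p%:Z = 2%:Z * x ^+ 2 + x * y + 3%:Z * y ^+ 2 ->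
  csym p (2%:Z * (x + y), 3%:Z * y) != 0.
Proof.
move=> p_pr p2 p3 pE.
have [y_odd py] := prime_nonprincipal_ndvd p_pr p2 pE.
have n3 : ~~ (3 %| 2 * p)%N by rewrite Euclid_dvdM // negb_or !dvdn_prime2 // (eq_sym 3%N p).
have cpB : coprime (2 * p) `|y|%N.
  by rewrite coprimeMl !prime_coprime ?y_odd.
have [|M [chi [cM]]] := @char3_norm_form (2 * p)%N (2%:Z * (x + y)) y _ n3 cpB.
  by rewrite PoszM pE; ring.
rewrite coprimeMl => /andP[c2 cp]; rewrite cM.1 // => chip cs.
rewrite cs ?dvdn_mull //; apply/eqP => chip0.
move: chip; rewrite chip0 addr0 -cs ?dvdn_mulr //.
(* As [y] is odd, the element is [w] modulo 2, and the symbol of [w] at 2 is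
   [(2 ^ 2 - 1) / 3 = 1]. *)
have [] // := @csym_mod 2 isT isT (2%:Z * (x + y), 3%:Z * y) (0, 1) 1.
- by rewrite /= mulr0 subr0 abszM dvdn_mulr.
- have d2 (n : int) : (2 %| `|n|)%N = ((n%:~R : 'F_2) == 0).
    by rewrite (intr_eq0_char _ (pchar_Fp (isT : prime 2))).
  move: y_odd; rewrite !d2 /= !(intrD, intrN, intrM).
  by move: (y%:~R : 'F_2) => [[|[|?]] ?].
by move=> _ ->; rewrite csym_symw.
Qed.

(** * Forms of discriminant -23 *)

Definition princ_form (x y : int) : int := x ^+ 2 + x * y + 6%:Z * y ^+ 2.
Definition other_form (x y : int) : int := 2%:Z * x ^+ 2 + x * y + 3%:Z * y ^+ 2.

(** Gauss reduction by induction on [a]: translate [b] into [[-a, a)], and exchange the outer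
    coefficients while [c' < a]. At the end [3 a^2 <= 23], so [a] is 1 or 2. The classes of
    [2 x^2 + x y + 3 y^2] and [2 x^2 - x y + 3 y^2] take the same values, so two cases remain. *)
Lemma forms_disc23 (a b c : int) : 0 < a -> b ^+ 2 - 4%:Z * a * c = - 23%:Z ->
  (forall u v, exists x y, a * u ^+ 2 + b * u * v + c * v ^+ 2 = princ_form x y) \/
  (forall u v, exists x y, a * u ^+ 2 + b * u * v + c * v ^+ 2 = other_form x y).
Proof.
have [n] := ubnP `|a|%N; elim: n a b c => // n IHn a b c; rewrite ltnS => le_an a0 disc.
pose k := ((b + a) %/ (2%:Z * a))%Z.
pose b' := b - 2%:Z * a * k; pose c' := c - b * k + a * k ^+ 2.
have b'1 : - a <= b' < a.
  have := divz_eq (b + a) (2%:Z * a); rewrite -/k.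
  have a20 : 2%:Z * a != 0 by clear -a0; lia.
  have := modz_ge0 (b + a) a20; have := ltz_mod (b + a) a20.
  move: (modz _ _) => r; rewrite /b'; clear -a0; move: k => k.
  rewrite gtr0_norm; lia.
have disc' : b' ^+ 2 - 4%:Z * a * c' = - 23%:Z by rewrite -disc /b' /c'; ring.
have c'0 : 0 < c' by clear -disc' a0; nia.
have fE u v : a * u ^+ 2 + b * u * v + c * v ^+ 2 =
  a * (u + k * v) ^+ 2 + b' * (u + k * v) * v + c' * v ^+ 2.
  by rewrite /b' /c'; ring.
have [lt_ca|le_ac] := ltP c' a.
  have lt_cn : (`|c'| < n)%N by apply: leq_trans le_an; clear -lt_ca a0 c'0; lia.
  have disc2 : b' ^+ 2 - 4%:Z * c' * a = - 23%:Z by rewrite -disc'; ring.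
  have [IH|IH] := IHn c' b' a lt_cn c'0 disc2; [left|right] => u v;
    have [x [y xy]] := IH v (u + k * v); exists x, y; rewrite -xy fE; ring.
have a2 : a = 1 \/ a = 2%:Z.
  have : a * a <= 7%:Z by clear -disc' le_ac b'1 a0; nia.
  by clear -a0; nia.
case: a2 => aE; rewrite aE in b'1 disc'.
  have [b'E|b'E] : b' = -1 \/ b' = 0 by clear -b'1; move: b' b'1 => z; lia.
    have c'E : c' = 6%:Z by move: disc'; rewrite b'E; clear; move: c' => z; lia.
    left=> u v; exists (u + k * v), (- v); rewrite fE aE b'E c'E /princ_form; ring.
  by move: disc'; rewrite b'E; clear; move: c' => z; lia.
have : b' = - 2%:Z \/ b' = 0 \/ b' = 1 \/ b' = -1.
  by clear -b'1; move: b' b'1 => z; lia.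
case=> [e|[e|b'E]].
- by move: disc'; rewrite e; clear; move: c' => z; lia.
- by move: disc'; rewrite e; clear; move: c' => z; lia.
have c'E : c' = 3%:Z.
  by case: b'E => e; move: disc'; rewrite e; clear; move: c' => z; lia.
right=> u v; case: b'E => e.
  exists (u + k * v), v; rewrite fE aE e c'E /other_form; ring.
exists (u + k * v), (- v); rewrite fE aE e c'E /other_form; ring.
Qed.

(** * Roots of X^3 - X - 1 and the Frobenius *)

(** Viete's relations for X^3 - X - 1. They count roots with multiplicity, so the double root at 23
    is covered, and they can be checked by [ring]. *)
Definition padovan_roots (F : nzRingType) (x y z : F) : Prop :=
  [/\ x + y + z = 0, x * y + y * z + z * x = -1 & x * y * z = 1].

Lemma padovan_roots_rot (F : comNzRingType) (x y z : F) :
  padovan_roots x y z -> padovan_roots y z x.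
Proof. by case=> e1 e2 e3; split; [rewrite -e1|rewrite -e2|rewrite -e3]; ring. Qed.

Lemma padovan_roots_swap (F : comNzRingType) (x y z : F) :
  padovan_roots x y z -> padovan_roots x z y.
Proof. by case=> e1 e2 e3; split; [rewrite -e1|rewrite -e2|rewrite -e3]; ring. Qed.

Section Roots.
Variables (F : fieldType) (x y z : F).
Hypothesis xyz : padovan_roots x y z.

Lemma padovan_factor u : u ^+ 3 - u - 1 = (u - x) * (u - y) * (u - z).
Proof.
case: xyz => e1 e2 e3.
transitivity (u ^+ 3 - (x + y + z) * u ^+ 2 + (x * y + y * z + z * x) * u - x * y * z).
  by rewrite e1 e2 e3; ring.
by ring.
Qed.

Lemma padovan_rootP u : u ^+ 3 - u - 1 = 0 -> [\/ u = x, u = y | u = z].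
Proof.
move=> /eqP; rewrite padovan_factor !mulf_eq0 !subr_eq0 => /orP[/orP[]|] /eqP ->.
- by constructor 1.
- by constructor 2.
- by constructor 3.
Qed.

Lemma padovan_root1 : x ^+ 3 - x - 1 = 0.
Proof. by rewrite padovan_factor subrr !mul0r. Qed.

Definition delta := (x - y) * (y - z) * (z - x).

Lemma z_eq : z = - x - y.
Proof. by case: xyz => e1 _ _; apply/eqP; rewrite -subr_eq0 -e1; apply/eqP; ring. Qed.

Lemma delta_sqr : delta ^+ 2 = - 23%:R.
Proof.
case: xyz => e1 e2 e3; rewrite /delta.
transitivity (- 4%:R * (x * y + y * z + z * x) ^+ 3 - 27%:R * (x * y * z) ^+ 2).
  by rewrite z_eq; ring.
by rewrite e2 e3; ring.
Qed.

Variable p : nat.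
Hypotheses (cp : p \in [pchar F]) (p23 : p != 23%N).

Lemma delta_neq0 : delta != 0.
Proof.
have : (delta ^+ 2 != 0) by rewrite delta_sqr oppr_eq0 (natr_eq0_char _ cp) dvdn_prime2 // (pcharf_prime cp).
by rewrite expf_eq0.
Qed.

Lemma roots_neq : [/\ x != y, y != z & z != x].
Proof. by have := delta_neq0; rewrite /delta !mulf_eq0 !negb_or !subr_eq0 => /andP[/andP[-> ->] ->]. Qed.

Lemma frob_padovan_root (u : F) : u ^+ 3 - u - 1 = 0 -> (u ^+ p) ^+ 3 - u ^+ p - 1 = 0.
Proof.
move=> h; have : (u ^+ 3 - u - 1) ^+ p = 0.
  by rewrite h expr0n gtn_eqF // prime_gt0 ?(pcharf_prime cp).
by rewrite !(frobB cp) expr1n -!exprM mulnC.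
Qed.

Lemma frob_inj : injective (fun u : F => u ^+ p).
Proof.
move=> u v /= /eqP; rewrite -subr_eq0 -(frobB cp) expf_eq0 subr_eq0.
by case/andP=> _ /eqP.
Qed.

End Roots.

(** Frobenius permutes the three distinct roots. The list is ordered as identity, transpositions,
    3-cycles, and later case splits rely on this order. *)
Lemma frob_cases (F : fieldType) (p : nat) (x y z : F) :
  padovan_roots x y z -> p \in [pchar F] -> p != 23%N ->
  (x ^+ p, y ^+ p, z ^+ p) \in
    [:: (x, y, z); (x, z, y); (z, y, x); (y, x, z); (y, z, x); (z, x, y)].
Proof.
move=> xyz cp p23.
have [nxy nyz nzx] := roots_neq xyz cp p23.
have rx := padovan_root1 xyz.
have ry := padovan_root1 (padovan_roots_rot xyz).
have rz := padovan_root1 (padovan_roots_rot (padovan_roots_rot xyz)).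
have fx := padovan_rootP xyz (frob_padovan_root cp rx).
have fy := padovan_rootP xyz (frob_padovan_root cp ry).
have fz := padovan_rootP xyz (frob_padovan_root cp rz).
have hxy : x ^+ p <> y ^+ p by move/(frob_inj cp)/eqP; apply/negP.
have hyz : y ^+ p <> z ^+ p by move/(frob_inj cp)/eqP; apply/negP.
have hzx : z ^+ p <> x ^+ p by move/(frob_inj cp)/eqP; apply/negP.
by case: fx fy fz hxy hyz hzx => -> [] -> [] -> // *; rewrite !inE eqxx ?orbT.
Qed.

(* Lagrange resolvents: with s = 2 w + 1 = sqrt(-3), the cube of
   x + w y + w^2 z is (27 - 3 s delta) / 2 = - 3 s (delta + 3 s) / 2. *)
Section Resolvent.
Variables (F : fieldType) (w x y z : F).
Hypotheses (w0 : w ^+ 2 + w + 1 = 0) (xyz : padovan_roots x y z).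
Let w2 := cube_rootX2 w0.

Definition resolvent (v : F) : F := x + v * y + v ^+ 2 * z.

Lemma resolvent_norm : resolvent w * resolvent (w ^+ 2) = 3%:R.
Proof.
case: xyz => e1 e2 e3; rewrite /resolvent w2.
transitivity ((x + y + z) ^+ 2 - 3%:R * (x * y + y * z + z * x)); first by ring: w2.
by rewrite e1 e2; ring.
Qed.

Lemma resolvent_cube :
  2%:R * resolvent w ^+ 3 = - 3%:R * (2%:R * w + 1) * (delta x y z + 3%:R * (2%:R * w + 1)).
Proof.
case: (xyz) => e1 e2 e3; rewrite /resolvent /delta w2.
transitivity (27%:R * (x * y * z) - 3%:R * (2%:R * w + 1) * ((x - y) * (y - z) * (z - x))).
  by rewrite (z_eq xyz); ring: w2.
by rewrite e3; ring: w2.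
Qed.

End Resolvent.

Lemma resolvent_frob (F : fieldType) p (v x y z : F) : p \in [pchar F] ->
  resolvent x y z v ^+ p = resolvent (x ^+ p) (y ^+ p) (z ^+ p) (v ^+ p).
Proof.
by move=> cp; rewrite /resolvent !(frobD cp) !exprMn; congr (_ + _ * _); exact: exprAC.
Qed.

Lemma ratio_cube (F : fieldType) (k b c t t' u v : F) :
  k != 0 -> t' != 0 -> v != 0 -> k * t = - b * (c * u ^+ 3) ->
  k * t' = b * (c * v ^+ 3) -> t / t' = - (u / v) ^+ 3.
Proof.
move=> k0 t0 v0 hu hv.
have h : t * v ^+ 3 = - u ^+ 3 * t'.
  apply: (mulfI k0); transitivity (k * t * v ^+ 3); first by ring.
  by transitivity (- u ^+ 3 * (k * t')); [rewrite hu hv|]; ring.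
by apply/eqP; rewrite expr_div_n -mulNr eqr_div ?expf_neq0 // h.
Qed.

Lemma ratio_twist (F : fieldType) (v t t' : F) : v != 0 -> t != 0 -> t' != 0 ->
  v ^+ 2 * t / (v * t') / (t / t') = v /\ v * t' / (v ^+ 2 * t) * (t / t') = v^-1.
Proof. by move=> v0 t0 t0'; split; field; rewrite ?v0 ?t0 ?t0'. Qed.

(** * The cubic symbol and the Frobenius permutation *)

Section Link.
Variables (p : nat) (x y z : Fbar p).
Hypotheses (p_pr : prime p) (p2 : p != 2%N) (p3 : p != 3%N) (xyz : padovan_roots x y z).
Let cp := Fbar_char p_pr.
Let w := om p.
Let w0 : w ^+ 2 + w + 1 = 0 := om0 p.
Let th := resolvent x y z w.
Let th' := resolvent x y z (w ^+ 2).
Let m := ((p + 1) %/ 3)%N.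

Lemma resolvents_neq0 : th != 0 /\ th' != 0.
Proof.
by apply/andP; rewrite -negb_or -mulf_eq0 resolvent_norm // Fbar3.
Qed.

Lemma even_third : ~~ odd m.
Proof.
have : odd p by case: (even_prime p_pr) => // /eqP; rewrite (negPf p2).
move=> po; have : odd (3 * m) = false.
  case: (prime_mod3 p_pr p3) => -[pE _]; rewrite -/m in pE.
    by move: po; rewrite pE addn1 /= => /negPf.
  have -> : (3 * m = p.+1)%N by move: (prime_gt0 p_pr) pE; clear; lia.
  by rewrite /= po.
by rewrite oddM /= => ->.
Qed.

(** Modulo p, [A] is [delta B] or [- delta B], so by [resolvent_cube] the ratio of evaluations is
    [- (th / th') ^+ 3] or its inverse. The sign disappears because [m] is even, and an inversion
    does not affect being 1. *)
Lemma csym_resolvent (h B : int) : (B%:~R : Fbar p) != 0 ->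
  ((2%:Z * h - 3%:Z * B)%:~R : Fbar p) ^+ 2 = - 23%:R * B%:~R ^+ 2 ->
  ((csym p (h, 3%:Z * B) == 0) = ((th / th') ^+ (3 * m) == 1)).
Proof.
move=> B0; set A := (_%:~R : Fbar p) => hA; rewrite -/A in hA.
set b := (B%:~R : Fbar p) in B0 hA *.
have [n1 n2] := resolvents_neq0.
have F2 : (2%:R : Fbar p) != 0 by rewrite (natr_eq0_char _ cp) dvdn_prime2 // eq_sym.
have F3 := Fbar3 p_pr p3.
pose e : eis := (h, 3%:Z * B).
pose s := 2%:R * w + 1 : Fbar p.
have w2 := cube_rootX2 w0.
have s2 : s ^+ 2 = - 3%:R by rewrite /s; ring: w2.
have s0 : s != 0.
  by apply: contra_neq F3 => s0; apply/eqP; rewrite -oppr_eq0 -s2 s0 expr0n.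
have E1 : 2%:R * ev w e = A + 3%:R * b * s.
  rewrite /ev /e /A /b /s /= !(intrD, intrN, intrM); ring.
have E2 : 2%:R * ev (w ^+ 2) e = A - 3%:R * b * s.
  rewrite /ev /e /A /b /s /= !(intrD, intrN, intrM); ring: w2.
have Ne : ~~ (p %| enorm e)%N.
  rewrite -(natr_eq0_char _ cp) -(ev_norm w0).
  rewrite -(inj_eq (mulfI (mulf_neq0 F2 F2))) mulr0 mulrACA E1 E2.
  have -> : (A + 3%:R * b * s) * (A - 3%:R * b * s) = 2%:R * 2%:R * b ^+ 2.
    by transitivity (A ^+ 2 - 9%:R * b ^+ 2 * s ^+ 2); [ring | rewrite hA s2; ring].
  by rewrite !mulf_neq0 ?expf_neq0.
have [e1 e2] := ev_norm_neq0 w0 cp Ne.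
have T1 := resolvent_cube w0 xyz; rewrite -/th -/s in T1.
have T2 := resolvent_cube (cube_root_sqr w0) xyz; rewrite -/th' in T2.
have sw : 2%:R * w ^+ 2 + 1 = - s by rewrite /s w2; ring.
rewrite sw in T2.
set d := delta x y z in T1 T2.
have hz : ev w e / ev (w ^+ 2) e = - (th / th') ^+ 3 \/
          ev w e / ev (w ^+ 2) e = - (th' / th) ^+ 3.
  have : (A - d * b) * (A + d * b) = 0.
    transitivity (A ^+ 2 - d ^+ 2 * b ^+ 2); first by ring.
    by rewrite hA (delta_sqr xyz) subrr.
  have K0 : 3%:R * s * 2%:R != 0 by rewrite !mulf_neq0.
  move=> /eqP; rewrite mulf_eq0 subr_eq0 addr_eq0 => /orP[/eqP hAd|/eqP hAd].
    left; apply: (ratio_cube (b := b) (c := 2%:R) K0) => //; rewrite -(mulrA (3%:R * s)) ?E1 ?E2 ?T1 ?T2 hAd; ring.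
  right; apply: (ratio_cube (b := b) (c := 2%:R) K0) => //; rewrite -(mulrA (3%:R * s)) ?E1 ?E2 ?T1 ?T2 hAd; ring.
have ord0 : (csym p e == 0) = ((ev w e / ev (w ^+ 2) e) ^+ m == 1).
  have -> : (csym p e == 0) = (w ^+ csym p e == 1).
    by rewrite -(inj_eq (expZ3_inj w0 F3) (csym p e) 0).
  rewrite (csymE p_pr p3 Ne) -/w -/m; case: ifP => // _.
  by rewrite -invf_div exprVn invr_eq1.
have Nm (u : Fbar p) : (- u ^+ 3) ^+ m = u ^+ (3 * m).
  by rewrite -[in RHS](odd_double_half m) (negPf even_third) -[in LHS](odd_double_half m) (negPf even_third) !add0n -mul2n exprM sqrrN -!exprM mulnA.
rewrite ord0; case: hz => ->; rewrite Nm //.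
by rewrite -invf_div exprVn invr_eq1.
Qed.


Let om_p1 : (p %% 3 = 1)%N -> w ^+ p = w.
Proof. by move=> pm; rewrite -(expr_mod _ (cube_root3 w0)) pm. Qed.

Let om_p2 : (p %% 3 = 2)%N -> w ^+ p = w ^+ 2.
Proof. by move=> pm; rewrite -(expr_mod _ (cube_root3 w0)) pm. Qed.

Let w4 : (w ^+ 2) ^+ 2 = w.
Proof. by rewrite -exprM (exprD w 3 1) (cube_root3 w0) mul1r. Qed.

Lemma resolvent_ratio_frob (u : Fbar p) : u != 0 ->
  u ^+ (3 * m) = if (p %% 3 == 1)%N then u ^+ p / u else u ^+ p * u.
Proof.
move=> u0; case: (prime_mod3 p_pr p3) => -[pE pm]; rewrite pm /= -/m in pE *.
  by apply: (mulIf u0); rewrite divfK // -exprSr -addn1 -pE.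
by rewrite -exprSr; congr (_ ^+ _); move: (prime_gt0 p_pr) pE; clear; lia.
Qed.

Lemma resolvent_ratio_fixed : x ^+ p = x -> y ^+ p = y -> z ^+ p = z ->
  (th / th') ^+ (3 * m) == 1.
Proof.
move=> fx fy fz; have [n1 n2] := resolvents_neq0.
have n3 : th / th' != 0 by rewrite mulf_neq0 ?invr_eq0.
rewrite resolvent_ratio_frob // expr_div_n !(resolvent_frob _ _ _ _ cp) fx fy fz exprAC.
case: (prime_mod3 p_pr p3) => -[_ pm]; rewrite pm /=.
  by rewrite om_p1 // -/th -/th' mulfV.
by rewrite om_p2 // w4 -/th -/th' -[th' / th]invf_div mulVf.
Qed.

(** Rotating the roots multiplies [th] by [w ^+ 2] and [th'] by [w]. This leaves a factor [w] or its
    inverse, which is not 1. *)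
Lemma resolvent_ratio_cycle : x ^+ p = y -> y ^+ p = z -> z ^+ p = x ->
  (th / th') ^+ (3 * m) != 1.
Proof.
move=> fx fy fz; have [n1 n2] := resolvents_neq0.
have n3 : th / th' != 0 by rewrite mulf_neq0 ?invr_eq0.
rewrite resolvent_ratio_frob // expr_div_n !(resolvent_frob _ _ _ _ cp) fx fy fz exprAC.
have w2 := cube_rootX2 w0; have wn := cube_root_neq0 w0.
have r1 : resolvent y z x w = w ^+ 2 * th by rewrite /th /resolvent w2; ring: w2.
have r2 : resolvent y z x (w ^+ 2) = w * th' by rewrite /th' /resolvent w2; ring: w2.
have w1 := cube_root_neq1 w0 (Fbar3 p_pr p3).
case: (prime_mod3 p_pr p3) => -[_ pm]; rewrite pm /=.
  rewrite om_p1 // r1 r2.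
  suff -> : w ^+ 2 * th / (w * th') / (th / th') = w by [].
  exact: (proj1 (ratio_twist wn n1 n2)).
rewrite om_p2 // w4 r1 r2.
have -> : w * th' / (w ^+ 2 * th) * (th / th') = w^-1.
  exact: (proj2 (ratio_twist wn n1 n2)).
by rewrite invr_eq1.
Qed.

End Link.

Lemma delta_frob (F : fieldType) p (x y z : F) : p \in [pchar F] ->
  delta x y z ^+ p = delta (x ^+ p) (y ^+ p) (z ^+ p).
Proof. by move=> cp; rewrite /delta !exprMn !(frobB cp). Qed.

Lemma not_fixed_neg (F : fieldType) p (d : F) : p \in [pchar F] -> p != 2%N ->
  d != 0 -> d != - d.
Proof.
move=> cp p2 d0; rewrite -subr_eq0 opprK -mulr2n -mulr_natr mulf_neq0 //.
by rewrite (natr_eq0_char _ cp) dvdn_prime2 // (pcharf_prime cp).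
Qed.

(** [delta] is [X / Y] up to sign, hence in the prime field. Transpositions would negate it, and the
    trivial symbol excludes 3-cycles. *)
Theorem principal_form_fixed p (x y z : Fbar p) (X Y : int) :
  prime p -> p != 2%N -> p != 3%N -> p != 23%N -> padovan_roots x y z ->
  p%:Z = X ^+ 2 + 23%:Z * Y ^+ 2 -> [/\ x ^+ p = x, y ^+ p = y & z ^+ p = z].
Proof.
move=> p_pr p2 p3 p23 xyz pE; have cp := Fbar_char p_pr.
have cs := csym_principal p_pr p2 p3 pE.
have p0 : (p%:Z%:~R : Fbar p) = 0 by apply/eqP; rewrite (natr_eq0_char _ cp).
have XY : (X%:~R : Fbar p) ^+ 2 = - 23%:R * Y%:~R ^+ 2.
  move: p0; rewrite pE intrD intrM !expr2 !intrM => /eqP; rewrite addr_eq0 => /eqP->.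
  by rewrite mulNr.
have Y0 : (Y%:~R : Fbar p) != 0.
  by rewrite (intr_eq0_char _ cp) (prime_principal_ndvd p_pr pE).
have F2 : (2%:R : Fbar p) != 0 by rewrite (natr_eq0_char _ cp) dvdn_prime2 // eq_sym.
have dp : delta x y z ^+ p = delta x y z.
  have : (delta x y z * Y%:~R - X%:~R) * (delta x y z * Y%:~R + X%:~R) = 0.
    transitivity (delta x y z ^+ 2 * Y%:~R ^+ 2 - X%:~R ^+ 2); first by ring.
    by rewrite (delta_sqr xyz) XY subrr.
  move=> /eqP; rewrite mulf_eq0 subr_eq0 addr_eq0 => /orP[]/eqP h;
    apply: (mulIf Y0); rewrite -{1}(frob_int cp Y) -exprMn h.
    by rewrite (frob_int cp).
  by rewrite (frobN cp) (frob_int cp).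
have d0 := delta_neq0 xyz cp p23.
have dneg := not_fixed_neg cp p2 d0.
move: dp; rewrite (delta_frob _ _ _ cp).
have cyc (x' y' z' : Fbar p) : padovan_roots x' y' z' -> x' ^+ p = y' -> y' ^+ p = z' -> z' ^+ p = x' -> False.
  move=> xyz' fx fy fz.
  have := resolvent_ratio_cycle p_pr p3 xyz' fx fy fz; apply/negP; rewrite negbK.
  rewrite -(csym_resolvent p_pr p2 p3 xyz' (h := X + 3%:Z * Y) (B := 2%:Z * Y)).
  - by apply/eqP; rewrite -cs; congr (csym _ (_, _)); ring.
  - by rewrite intrM mulf_neq0.
  have -> : 2%:Z * (X + 3%:Z * Y) - 3%:Z * (2%:Z * Y) = 2%:Z * X by ring.
  by rewrite !intrM !exprMn XY; ring.
have := frob_cases xyz cp p23; rewrite !inE !xpair_eqE.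
case/or4P => [|||/or3P[]] /andP[/andP[/eqP fx /eqP fy] /eqP fz]; rewrite fx fy fz => // dE.
- by case/eqP: dneg; rewrite -{1}dE /delta; ring.
- by case/eqP: dneg; rewrite -{1}dE /delta; ring.
- by case/eqP: dneg; rewrite -{1}dE /delta; ring.
- by case: (cyc x y z).
- by case: (cyc x z y) => //; exact: padovan_roots_swap.
Qed.

(** [X^p - X] has no root besides the [p] images of naturals. Writing fixed elements as naturals is
    also what carries relations from one field of characteristic p to another. *)
Lemma frob_fixed_nat (F : fieldType) p (u : F) : p \in [pchar F] ->
  u ^+ p = u -> exists n : nat, u = n%:R.
Proof.
move=> cp up; have p_pr := pcharf_prime cp; have p1 := prime_gt1 p_pr.
pose P : {poly F} := 'X^p - 'X.
pose s : seq F := [seq n%:R | n <- iota 0 p].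
have us : uniq s.
  rewrite map_inj_in_uniq ?iota_uniq // => i j; rewrite !mem_iota add0n /= => hi hj.
  by move/eqP; rewrite (natr_eq_char _ _ cp) !modn_small // => /eqP.
have sP : size P = p.+1.
  by rewrite size_polyDl ?size_polyXn // size_polyN size_polyX.
have P0 : P != 0 by rewrite -size_poly_eq0 sP.
have rootE v : root P v = (v ^+ p == v) by rewrite rootE !hornerE subr_eq0.
have [/mapP[n _ ->]|us'] := boolP (u \in s); first by exists n.
have : all (root P) (u :: s).
  rewrite /= rootE up eqxx /=; apply/allP => _ /mapP[n _ ->].
  by rewrite rootE (frob_nat cp).
move/(max_poly_roots P0)/(_ _); rewrite /= us' us => /(_ isT).
by rewrite sP size_map size_iota ltnn.
Qed.

(** [delta] lies in the prime field and squares to -23. Lifting it gives a form of discriminant -23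
    with leading coefficient p; the nonprincipal alternative would make the symbol nonzero, although
    the roots are fixed. *)
Theorem fixed_principal_form p (x y z : Fbar p) :
  prime p -> p != 2%N -> p != 3%N -> padovan_roots x y z ->
  x ^+ p = x -> y ^+ p = y -> z ^+ p = z ->
  exists X Y : int, p%:Z = X ^+ 2 + 23%:Z * Y ^+ 2.
Proof.
move=> p_pr p2 p3 xyz fx fy fz; have cp := Fbar_char p_pr.
have p_odd : odd p by case: (even_prime p_pr) => // /eqP; rewrite (negPf p2).
have [n nE] : exists n : nat, delta x y z = n%:R.
  by apply: (frob_fixed_nat cp); rewrite (delta_frob _ _ _ cp) fx fy fz.
(* Adding the odd [p] if needed makes the lift odd, so that 4 also divides [b ^ 2 + 23]. *)
have [b b_odd bE] : exists2 b : nat, odd b & delta x y z = b%:R.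
  case no : (odd n); first by exists n.
  exists (n + p)%N; first by rewrite oddD no p_odd.
  by rewrite natrD (pcharf0 cp) addr0.
have dvdb : (p %| b ^ 2 + 23)%N.
  rewrite -(natr_eq0_char _ cp) natrD natrX -bE (delta_sqr xyz).
  by rewrite addNr.
have dvd4 : (4 %| b ^ 2 + 23)%N.
  rewrite -(odd_double_half b) b_odd -mul2n.
  apply/dvdnP; exists (b./2 ^ 2 + b./2 + 6)%N; clear; nia.
have /dvdnP[c cE] : (p * 4 %| b ^ 2 + 23)%N.
  by rewrite Gauss_dvd ?dvdb // prime_coprime // -[4%N]/(2 ^ 2)%N Euclid_dvdX // dvdn_prime2 // (negPf p2).
have disc : b%:Z ^+ 2 - 4%:Z * p%:Z * c%:Z = - 23%:Z by clear -cE; nia.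
have p0 : 0 < p%:Z by rewrite ltz_nat prime_gt0.
have at10 v : p%:Z * 1 ^+ 2 + b%:Z * 1 * 0 + c%:Z * 0 ^+ 2 = v -> p%:Z = v.
  by move=> <-; ring.
have [pf|pf] := forms_disc23 p0 disc; have [X [Y /at10 pE]] := pf 1 0.
  (* Modulo 2 the principal form is [X (X + Y)], odd only if [Y] is even. With [Y = 2 k] it becomes
     [(X + k)^2 + 23 k^2]. *)
  have Y2 : (2 %| `|Y|)%N.
    have d2 (k : int) : (2 %| `|k|)%N = ((k%:~R : 'F_2) == 0).
      by rewrite (intr_eq0_char _ (pchar_Fp (isT : prime 2))).
    have : ~~ (2 %| `|p%:Z|)%N by rewrite /= dvdn2 negbK p_odd.
    rewrite pE !d2 /princ_form !expr2 !(intrD, intrN, intrM).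
    have -> : (6%:Z%:~R : 'F_2) = 0 by apply: val_inj.
    by move: (X%:~R : 'F_2) (Y%:~R : 'F_2) => [[|[|?]] ?] [[|[|?]] ?].
  have /(@intdiv.dvdzP 2%:Z)[k kE] := Y2.
  by exists (X + k), k; rewrite pE /princ_form kE; ring.
have [_ pY] := prime_nonprincipal_ndvd p_pr p2 pE.
have /negP[] := csym_nonprincipal p_pr p2 p3 pE.
rewrite (csym_resolvent p_pr p2 p3 xyz); first exact: resolvent_ratio_fixed.
  by rewrite (intr_eq0_char _ cp).
have : ((8%:Z * p%:Z)%:~R : Fbar p) = 0.
  by rewrite intrM; apply/eqP; rewrite mulf_eq0 [X in _ || X](natr_eq0_char _ cp) dvdnn orbT.
rewrite pE /other_form => h0; apply/eqP; rewrite -subr_eq0 -{}h0.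
by rewrite !expr2 !(intrD, intrN, intrM); apply/eqP; ring.
Qed.

(** * Degree of the splitting field *)

Lemma padovan_roots_neq0 (F : fieldType) (x y z : F) :
  padovan_roots x y z -> [/\ x != 0, y != 0 & z != 0].
Proof.
case=> _ _ e3; have : x * y * z != 0 by rewrite e3 oner_eq0.
by rewrite !mulf_eq0 !negb_or => /andP[/andP[-> ->] ->].
Qed.

Section MultOrder.
Variables (p : nat) (L : fieldExtType 'F_p).

Lemma mult_orderP (x : L) n : x != 0 -> (x ^+ n == 1) = (mult_order x %| n)%N.
Proof.
move=> x0; rewrite /mult_order cyclic.order_dvdn.
set u := insubd _ _.
have uE : \val u = x :> finvect_type L by rewrite val_insubd unitfE x0.
transitivity ((\val u : finvect_type L) ^+ n == 1); first by rewrite uE.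
by rewrite -val_eqE -FinRing.val_unitX.
Qed.

Lemma mult_order_gt0 (x : L) : (0 < mult_order x)%N.
Proof. exact: order_gt0. Qed.

Lemma expr_mult_order (x : L) : x != 0 -> x ^+ mult_order x = 1.
Proof. by move=> x0; apply/eqP; rewrite mult_orderP. Qed.

Hypothesis p_pr : prime p.

Lemma fieldExt_char : p \in [pchar L].
Proof. by rewrite (pchar_lalg L) pchar_Fp. Qed.

Let cp := fieldExt_char.

Lemma frob_fixedP (x : L) : reflect (x ^+ p = x) (x \in 1%VS).
Proof.
apply: (iffP idP) => [/vlineP[a ->]|/(frob_fixed_nat cp)[n ->]].
  rewrite exprZn expr1n; congr (_ *: _).
  by have := expf_card a; rewrite card_Fp.
by apply/vlineP; exists n%:R; rewrite scaler_nat.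
Qed.

Lemma horner_frob (P : {poly L}) x : P \is a polyOver 1%VS ->
  P.[x ^+ p] = P.[x] ^+ p.
Proof.
move=> /polyOverP P1; rewrite !horner_coef (frob_sum cp).
apply: eq_bigr => i _; rewrite exprMn exprAC; congr (_ * _).
by apply/esym/frob_fixedP.
Qed.

Definition roots_field (x y z : L) : {subfield L} := <<1 & [:: x; y; z]>>%AS.

Lemma dim_roots_field (x y z u : L) : u \in [:: x; y; z] ->
  {subset [:: x; y; z] <= <<1; u>>%VS} ->
  \dim (roots_field x y z) = adjoin_degree 1 u.
Proof.
move=> ux sub; have -> : (roots_field x y z : {vspace L}) = <<1; u>>%VS.
  apply/eqP; rewrite eqEsubv; apply/andP; split.
    by apply/Fadjoin_seqP; split=> //; exact: subv_adjoin.
  rewrite -adjoin_seq1; apply: adjoin_seqSr => v; rewrite inE => /eqP->.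
  exact: ux.
by rewrite dim_Fadjoin dimv1 muln1.
Qed.

Section Degree.
Variables x y z : L.
Hypothesis xyz : padovan_roots x y z.

Lemma dim_fixed : x ^+ p = x -> y ^+ p = y -> z ^+ p = z ->
  \dim (roots_field x y z) = 1%N.
Proof.
move=> /frob_fixedP fx /frob_fixedP fy /frob_fixedP fz.
rewrite (@dim_roots_field x y z x) ?mem_head //; last first.
  move=> u hu; apply: (subvP (subv_adjoin _ _)).
  by move: hu; rewrite !inE => /or3P[] /eqP->.
by apply/eqP; rewrite adjoin_deg_eq1.
Qed.

(** Frobenius fixes the coefficients of [(X - y) (X - z)], so the degree is at most 2; it is not 1
    since [y] is moved. *)
Lemma dim_swap : x ^+ p = x -> y ^+ p = z -> z ^+ p = y -> y != z ->
  \dim (roots_field x y z) = 2%N.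
Proof.
move=> /frob_fixedP fx fy fz yz.
have xE : x \in <<1; y>>%VS := subvP (subv_adjoin _ _) _ fx.
have yE : y \in <<1; y>>%VS := memv_adjoin _ _.
have zE : z \in <<1; y>>%VS.
  by rewrite (z_eq xyz) rpredB ?rpredN.
rewrite (@dim_roots_field x y z y) ?inE ?eqxx ?orbT //; last first.
  by move=> u; rewrite !inE => /or3P[] /eqP->.
apply/eqP; rewrite eqn_leq; apply/andP; split.
  have P1 : ('X - y%:P) * ('X - z%:P) \is a polyOver 1%VS.
    have -> : ('X - y%:P) * ('X - z%:P) = 'X^2 - (y + z)%:P * 'X + (y * z)%:P.
      by rewrite polyCD polyCM; ring.
    rewrite rpredD ?rpredB ?rpredM ?rpredX ?polyOverX // polyOverC; apply/frob_fixedP.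
      by rewrite (frobD cp) fy fz addrC.
    by rewrite exprMn fy fz mulrC.
  have Psz : size (('X - y%:P) * ('X - z%:P)) = 3%N.
    by rewrite size_Mmonic ?polyXsubC_eq0 ?monicXsubC // !size_XsubC.
  rewrite leqNgt; apply/negP => dy.
  have := root_small_adjoin_poly P1 (_ : size _ <= adjoin_degree 1 y)%N.
  rewrite Psz => /(_ dy); rewrite rootM root_XsubC eqxx /= => /esym/eqP P0.
  by move: Psz; rewrite P0 size_poly0.
have : adjoin_degree 1 y != 1%N.
  by rewrite adjoin_deg_eq1; apply: contra yz => /frob_fixedP; rewrite fy => ->.
by rewrite /adjoin_degree; case: _.-1.
Qed.

(** Frobenius carries roots of the minimal polynomial of [x] to roots, so it has all three and the
    degree is at least 3. *)
Lemma dim_cycle : x ^+ p = y -> y ^+ p = z -> z ^+ p = x ->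
  x != y -> y != z -> z != x -> \dim (roots_field x y z) = 3%N.
Proof.
move=> fx fy fz xy yz zx.
have xE : x \in <<1; x>>%VS := memv_adjoin _ _.
have yE : y \in <<1; x>>%VS by rewrite -fx rpredX.
have zE : z \in <<1; x>>%VS by rewrite -fy rpredX.
rewrite (@dim_roots_field x y z x) ?mem_head //; last first.
  by move=> u; rewrite !inE => /or3P[] /eqP->.
have M1 := minPolyOver 1 x.
have rx := root_minPoly 1 x.
have ry : root (minPoly 1 x) y.
  by rewrite rootE -fx horner_frob // (rootP rx) expr0n gtn_eqF // prime_gt0.
have rz : root (minPoly 1 x) z.
  by rewrite rootE -fy horner_frob // (rootP ry) expr0n gtn_eqF // prime_gt0.
apply/eqP; rewrite eqn_leq; apply/andP; split; last first.
  rewrite -ltnS -size_minPoly.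
  apply: (@max_poly_roots _ _ [:: x; y; z]).
  - by rewrite monic_neq0 ?monic_minPoly.
  - by rewrite /= rx ry rz.
  - by rewrite /= !inE negb_or xy yz (eq_sym x) zx.
pose P : {poly L} := 'X^3 - 'X - 1.
have P1 : P \is a polyOver 1%VS.
  by rewrite !rpredB ?rpredX ?polyOverX // rpred1.
have Psz : size P = 4%N.
  by rewrite /P -addrA -opprD size_polyDl size_polyXn // size_polyN size_XaddC.
have Px : root P x by rewrite rootE !hornerE (padovan_root1 xyz).
rewrite leqNgt; apply/negP => dx.
have := root_small_adjoin_poly P1 (_ : size _ <= adjoin_degree 1 x)%N.
rewrite Psz => /(_ dx); rewrite Px => /esym/eqP P0.
by move: Psz; rewrite P0 size_poly0.
Qed.

End Degree.
End MultOrder.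

Lemma dim_roots_field_perm p (L : fieldExtType 'F_p) (s t : seq L) :
  s =i t -> \dim <<1 & s>>%AS = \dim <<1 & t>>%AS.
Proof.
move=> st; congr (\dim _); apply/eqP; rewrite eqEsubv.
by apply/andP; split; apply: adjoin_seqSr => u; rewrite st.
Qed.

(** * Periods and orders of the roots *)

Section Padovan.

Lemma padovanSSS n : padovan n.+3 = (padovan n.+1 + padovan n)%N.
Proof. by []. Qed.

Lemma padovan_expr (F : comNzRingType) (u : F) n : u ^+ 3 = u + 1 ->
  u ^+ (n + 3) = (padovan n)%:R * u ^+ 2 + (padovan n.+1)%:R * u
                 + ((padovan n.+2)%:R - (padovan n)%:R).
Proof.
move=> u3; elim: n => [|n IHn]; first by rewrite u3 /= mulr0n mulr1n; ring.
rewrite addSn exprS IHn padovanSSS natrD.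
transitivity ((padovan n)%:R * u ^+ 3 + (padovan n.+1)%:R * u ^+ 2
   + ((padovan n.+2)%:R - (padovan n)%:R) * u); first by ring.
by rewrite u3; ring.
Qed.

Lemma quadratic_eq0 (F : fieldType) (a b c x y z : F) :
  x != y -> y != z -> z != x ->
  a * x ^+ 2 + b * x + c = 0 -> a * y ^+ 2 + b * y + c = 0 ->
  a * z ^+ 2 + b * z + c = 0 -> [/\ a = 0, b = 0 & c = 0].
Proof.
move=> xy yz zx hx hy hz.
have h1 : a * (x + y) + b = 0.
  apply: (mulfI (_ : x - y != 0)); rewrite ?subr_eq0 // mulr0.
  by rewrite -[RHS](subrr 0) -{1}hx -hy; ring.
have h2 : a * (y + z) + b = 0.
  apply: (mulfI (_ : y - z != 0)); rewrite ?subr_eq0 // mulr0.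
  by rewrite -[RHS](subrr 0) -{1}hy -hz; ring.
have a0 : a = 0.
  apply: (mulIf (_ : z - x != 0)); rewrite ?subr_eq0 // mul0r.
  by rewrite -[RHS](subrr 0) -{1}h2 -h1; ring.
have b0 : b = 0 by move: h1; rewrite a0 mul0r add0r.
by split=> //; move: hx; rewrite a0 b0 !mul0r !add0r.
Qed.

Lemma is_periodE (F : nzRingType) p n : p \in [pchar F] -> is_period p n =
  [&& (0 < n)%N, (padovan n)%:R == 0 :> F, (padovan n.+1)%:R == 1 :> F &
      (padovan n.+2)%:R == 1 :> F].
Proof. by move=> cp; rewrite /is_period /= -!(natr_eq_char _ _ cp). Qed.

(** [u ^+ (n + 3) = u ^+ 3] is a relation of degree at most 2 in [u]. Holding at three distinct
    roots, it holds coefficientwise; distinctness is where 23 is excluded. *)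
Lemma is_period_roots (F : fieldType) p n (x y z : F) :
  p \in [pchar F] -> p != 23%N -> padovan_roots x y z ->
  is_period p n = [&& (0 < n)%N, x ^+ n == 1, y ^+ n == 1 & z ^+ n == 1].
Proof.
move=> cp p23 xyz; rewrite (is_periodE _ cp).
have yzx := padovan_roots_rot xyz; have zxy := padovan_roots_rot yzx.
have u3 (u v t : F) : padovan_roots u v t -> u ^+ 3 = u + 1 /\ u != 0.
  move=> uvt; split; last by have [] := padovan_roots_neq0 uvt.
  by have /eqP := padovan_root1 uvt; rewrite -addrA -opprD subr_eq0 => /eqP.
have [x3 x0] := u3 _ _ _ xyz; have [y3 y0] := u3 _ _ _ yzx.
have [z3 z0] := u3 _ _ _ zxy.
congr (_ && _); apply/and3P/and3P => -[].
  move=> /eqP t0 /eqP t1 /eqP t2.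
  have h (u : F) : u ^+ 3 = u + 1 -> u != 0 -> u ^+ n == 1.
    move=> hu u0; apply/eqP/(mulIf (expf_neq0 3 u0)).
    by rewrite -exprD padovan_expr // t0 t1 t2 hu; ring.
  by split; apply: h.
move=> /eqP xn /eqP yn /eqP zn.
have [xy yz zx] := roots_neq xyz cp p23.
have h (u : F) : u ^+ 3 = u + 1 -> u ^+ n = 1 ->
  (padovan n)%:R * u ^+ 2 + ((padovan n.+1)%:R - 1) * u
                 + ((padovan n.+2)%:R - (padovan n)%:R - 1) = 0.
  move=> hu un; have := padovan_expr n hu; rewrite exprD un mul1r hu => /eqP.
  by rewrite -subr_eq0 => /eqP h0; rewrite -[RHS]oppr0 -h0; ring.
have [t0 t1 t2] := quadratic_eq0 xy yz zx (h _ x3 xn) (h _ y3 yn) (h _ z3 zn).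
move/eqP: t1; rewrite subr_eq0 => t1; split; rewrite ?t0 //.
by move/eqP: t2; rewrite t0 subr0 subr_eq0.
Qed.

End Padovan.

Section Period.
Variables (p : nat) (p_pr : prime p).
Let cp := pchar_Fp p_pr.

Lemma period_is_period : is_period p (period p_pr).
Proof. by rewrite /period; case: ex_minnP. Qed.

Lemma period_min n : is_period p n -> (period p_pr <= n)%N.
Proof. by rewrite /period; case: ex_minnP => m _ h /h. Qed.

Lemma omega_min n : n \in Omega p -> (omega p_pr <= n)%N.
Proof. by rewrite /omega; case: ex_minnP => m _ h /h. Qed.

Lemma padovan_shift t n : is_period p t -> padovan (n + t) = padovan n %[mod p].
Proof.
move=> /and4P[_ /eqP t0 /eqP t1 /eqP t2].
suff [] : [/\ padovan (n + t) = padovan n %[mod p],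
  padovan (n.+1 + t) = padovan n.+1 %[mod p] &
  padovan (n.+2 + t) = padovan n.+2 %[mod p]] by [].
elim: n => [|n [h0 h1 h2]]; first by [].
split=> //; rewrite 3!addSn !padovanSSS -!addSn.
by rewrite -modnDm h1 h0 modnDm.
Qed.

(** Running the recurrence backwards from 0, 1, 1 gives 1, 0, 0 at [t - 1], [t - 2], [t - 3]. Values
    of [t] up to 3 are impossible, which makes [t - 3] positive. *)
Lemma is_period_tail t : is_period p t ->
  exists n, [/\ t = (n + 3)%N, (0 < n)%N, p %| padovan n & p %| padovan n.+1]%N.
Proof.
case: t => [|[|[|[|n]]]] tP; try by move: tP; rewrite (is_periodE _ cp) /= ?addn0 ?mulr1n ?oner_eq0.
have rD k : (padovan k.+3)%:R = (padovan k.+1)%:R + (padovan k)%:R :> 'F_p.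
  by rewrite padovanSSS natrD.
exists n.+1; move: tP; rewrite (is_periodE _ cp) (rD n.+3) (rD n.+2).
case/and4P=> _ /eqP h0 /eqP h1 /eqP h2; rewrite h0 add0r in h2.
have b0 : (padovan n.+2)%:R = 0 :> 'F_p.
  by apply: (addrI (padovan n.+3)%:R); rewrite h1 addr0 h2.
have a0 : (padovan n.+1)%:R = 0 :> 'F_p by move: h0; rewrite (rD n.+1) b0 add0r.
by split; rewrite ?addn3 // -(natr_eq0_char _ cp) ?a0 ?b0.
Qed.

Lemma Omega_period_facts (t := period p_pr) :
  [/\ (t - 3)%N \in Omega_upto_period p_pr, (t - 2)%N \in Omega_upto_period p_pr
      & t \in Omega_upto_period p_pr] /\ (omega p_pr <= t - 3)%N.
Proof.
have tP := period_is_period; rewrite -/t in tP.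
have [n [tE n0 pn pn1]] := is_period_tail tP.
have pt : (p %| padovan t)%N by case/and4P: tP => _ /eqP; rewrite mod0n => /eqP.
have O3 : (t - 3)%N \in Omega p by rewrite tE addnK inE n0.
split; last exact: omega_min.
split; rewrite inE /= -/t.
- by rewrite O3 tE addnK n0 leq_addr.
- have -> : (t - 2 = n.+1)%N by rewrite tE addnS subSS addn2 subSS subn0.
  by rewrite inE /= pn1 /= tE addn3 leqW ?leqnSn.
- by rewrite !inE /= -/t pt leqnn tE addn3.
Qed.

Lemma Omega_periodic (t := period p_pr) n : n \in Omega p <->
  exists x k : nat, x \in Omega_upto_period p_pr /\ n = (x + k * t)%N.
Proof.
have tP := period_is_period; rewrite -/t in tP.
have t0 : (0 < t)%N by case/and4P: tP.
have shift m k : padovan (m + k * t) = padovan m %[mod p].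
  elim: k => [|k IHk]; first by rewrite mul0n addn0.
  by rewrite mulSnr addnA (padovan_shift _ tP).
have dvd m k : (p %| padovan (m + k * t))%N = (p %| padovan m)%N.
  by rewrite /dvdn shift.
split=> [|[x [k [xO ->]]]]; last first.
  move: xO; rewrite inE /= => /andP[]; rewrite !inE => /andP[x0 px] _.
  by rewrite dvd px addn_gt0 x0.
rewrite inE /= => /andP[n0 pn].
(* Dividing [n.-1] puts the residue in [1 .. t] instead of [0 .. t - 1]. *)
exists (n.-1 %% t).+1, (n.-1 %/ t)%N.
have nE : n = ((n.-1 %% t).+1 + n.-1 %/ t * t)%N.
  by rewrite addSn addnC -divn_eq prednK.
split=> //; rewrite !inE /= -/t ltn_pmod // andbT.
by rewrite nE dvd in pn.
Qed.

End Period.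

(** * The ramified prime 23, by computation *)

Definition pstep (s : nat * nat * nat) : nat * nat * nat :=
  (s.1.2, s.2, (s.1.1 + s.1.2) %% 23)%N.

Lemma pstep_iter n : iter n pstep (0, 1, 1)%N =
  (padovan n %% 23, padovan n.+1 %% 23, padovan n.+2 %% 23)%N.
Proof.
elim: n => [|n IHn] //; rewrite iterS IHn /pstep padovanSSS /=.
by rewrite modnDm addnC.
Qed.

Lemma is_period23 n : is_period 23 n = (0 < n)%N && (iter n pstep (0, 1, 1)%N == (0, 1, 1)%N).
Proof. by rewrite pstep_iter !xpair_eqE -andbA. Qed.

Lemma traject_ne (T : eqType) (f : T -> T) (x : T) n t :
  all (fun s => s != x) (behead (traject f x n)) -> (0 < t < n)%N -> iter t f x != x.
Proof.
move=> /allP h /andP[t0 tn]; apply: h; case: n tn => [//|n]; rewrite ltnS => tn.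
by case: t t0 tn => // t _ tn; rewrite iterSr; apply/trajectP; exists t.
Qed.

(** With a double root the orders of the roots no longer determine the period. The states, reduced
    modulo 23 at each step to keep numbers small, are enumerated; none of the 505 intermediate ones
    is the initial state. *)
Lemma period23 (p_pr : prime 23) : period p_pr = 506%N.
Proof.
apply/eqP; rewrite eqn_leq; apply/andP; split.
  by apply: period_min; rewrite is_period23; vm_compute.
rewrite leqNgt; apply/negP => lt506; have := period_is_period p_pr.
rewrite is_period23 => /andP[t0 /eqP].
have h : all (fun s => s != (0, 1, 1)%N) (behead (traject pstep (0, 1, 1)%N 506)).
  by vm_compute.
by apply/eqP; apply: (traject_ne h); rewrite t0.
Qed.

(** * Roots in the prime field, transfer between fields, and the primes 2 and 3 *)

Lemma padovan_roots_of_poly (K : comNzRingType) (x y z : K) :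
  padovan_poly K = ('X - x%:P) * ('X - y%:P) * ('X - z%:P) -> padovan_roots x y z.
Proof.
have -> : ('X - x%:P) * ('X - y%:P) * ('X - z%:P) =
  'X^3 - (x + y + z) *: 'X^2 + (x * y + y * z + z * x) *: 'X - (x * y * z)%:P.
  by rewrite -!mul_polyC !(polyCD, polyCM); ring.
rewrite /padovan_poly => /polyP h.
have := h 0%N; have := h 1%N; have := h 2%N.
rewrite !(coefD, coefN, coefZ, coefXn, coefX, coef1, coefC) /=.
move=> h2 h1 h0; split.
- by apply: oppr_inj; move: h2; rewrite !(mulr1, mulr0, subr0, addr0, sub0r, oppr0) => <-.
- by move: h1; rewrite !(mulr1, mulr0, subr0, addr0, add0r, sub0r, oppr0) => <-.
- by apply: oppr_inj; move: h0; rewrite !(mulr1, mulr0, subr0, addr0, add0r, sub0r, oppr0) => <-.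
Qed.

(** The right-hand side does not mention the field, so roots in the prime field pass from [L] to
    [Fbar p] and back. *)
Lemma padovan_roots_nat (F : nzRingType) p (a b c : nat) : p \in [pchar F] ->
  padovan_roots (a%:R : F) b%:R c%:R <->
  [&& p %| a + b + c, p %| a * b + b * c + c * a + 1 & a * b * c == 1 %[mod p]]%N.
Proof.
move=> cp; rewrite -!(natr_eq0_char _ cp) -(natr_eq_char _ _ cp) !(natrD, natrM).
split=> [[/eqP h1 /eqP h2 /eqP h3]|/and3P[/eqP h1 h2 /eqP h3]].
  by apply/and3P; split=> //; rewrite addr_eq0.
by split=> //; apply/eqP; rewrite -addr_eq0.
Qed.

Lemma no_fixed_root (F : fieldType) p (u : F) : p \in [pchar F] ->
  p = 2%N \/ p = 3%N -> u ^+ p = u -> u ^+ 3 - u - 1 = 0 -> False.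
Proof.
move=> cp p23 /(frob_fixed_nat cp)[n ->] /eqP.
rewrite -addrA -opprD subr_eq0 -natrX natr1 (natr_eq_char _ _ cp).
rewrite -modnXm -[in X in _ == X]addn1 -[in X in _ == X]modnDml; case: p23 => pE; rewrite pE.
  by have := ltn_pmod n (isT : 0 < 2)%N; case: (n %% 2)%N => [|[|]].
by have := ltn_pmod n (isT : 0 < 3)%N; case: (n %% 3)%N => [|[|[|]]].
Qed.

Lemma no_small_form p (X Y : int) : p = 2%N \/ p = 3%N ->
  p%:Z = X ^+ 2 + 23%:Z * Y ^+ 2 -> False.
Proof.
move=> p23 pE.
have Y0 : Y = 0.
  have p3 : p%:Z <= 3%:Z by case: p23 => ->.
  by clear p23; have := sqr_ge0 X; nia.
have {}pE : p%:Z = X * X by rewrite pE Y0; ring.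
have : X = -1 \/ X = 0 \/ X = 1.
  have p3 : p%:Z <= 3%:Z by case: p23 => ->.
  have X1 : - 2%:Z < X by clear p23; nia.
  have X2 : X < 2%:Z by clear p23; nia.
  by clear -X1 X2; lia.
by case: p23 pE => -> pE [|[]] XE; rewrite XE in pE.
Qed.

(** [x] solves the cubic and [y] its cofactor [Y^2 + x Y + x^2 - 1]; the third root is then forced
    by the zero sum. *)
Lemma closed_padovan_roots (F : closedFieldType) : exists x y z : F, padovan_roots x y z.
Proof.
have [x] := @solve_monicpoly F 3 (fun i => (i < 2)%:R) isT.
rewrite !big_ord_recl big_ord0 /= expr0 expr1 !mul1r mul0r !addr0 => hx.
have [y] := @solve_monicpoly F 2 (fun i => if i == 0%N then 1 - x ^+ 2 else - x) isT.
rewrite !big_ord_recl big_ord0 /= expr0 expr1 mulr1 addr0 => hy.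
exists x, y, (- x - y); split; first by ring.
  by transitivity (- x ^+ 2 - x * y - y ^+ 2); [ring | rewrite hy; ring].
transitivity (- x * (x * y + y ^+ 2)); first by ring.
by rewrite hy; transitivity (x ^+ 3 - x); [ring | rewrite hx; ring].
Qed.

Lemma padovan_roots_fixed23 (F : fieldType) p (x y z : F) : p = 23%N ->
  p \in [pchar F] -> padovan_roots x y z -> x ^+ p = x.
Proof.
move=> -> cp xyz.
have c23 : (23%:R : F) = 0 by apply/eqP; rewrite (natr_eq0_char _ cp).
(* Modulo 23 the cubic is [(X - 3) (X - 10)^2]. *)
have : (x - 3%:R) * (x - 10%:R) ^+ 2 = 0.
  transitivity (x ^+ 3 - x - 1 + 23%:R * (- x ^+ 2 + 7%:R * x - 13%:R)); first by ring.
  by rewrite (padovan_root1 xyz) c23 mul0r addr0.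
move/eqP; rewrite mulf_eq0 expf_eq0 /= !subr_eq0 => /orP[]/eqP->; exact: (frob_nat cp).
Qed.

Section Classify.
Variables (p : nat) (p_pr : prime p) (L : fieldExtType 'F_p).
Let cp := fieldExt_char L p_pr.

(** The degree is the order of the permutation that Frobenius induces on the roots. *)
Lemma roots_trichotomy (x y z : L) (r := \dim (roots_field x y z)) :
  padovan_roots x y z -> p != 23%N ->
  [\/ r = 1%N /\ [/\ x ^+ p = x, y ^+ p = y & z ^+ p = z],
      r = 2%N /\ [\/ [/\ x ^+ p = x, y ^+ p = z & z ^+ p = y],
                     [/\ y ^+ p = y, z ^+ p = x & x ^+ p = z] |
                     [/\ z ^+ p = z, x ^+ p = y & y ^+ p = x]]
    | r = 3%N /\ ([/\ x ^+ p = y, y ^+ p = z & z ^+ p = x] \/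
                  [/\ x ^+ p = z, z ^+ p = y & y ^+ p = x])].
Proof.
move=> xyz p23; have [xy yz zx] := roots_neq xyz cp p23.
have yzx := padovan_roots_rot xyz; have zxy := padovan_roots_rot yzx.
have xzy := padovan_roots_swap xyz.
have perm a b c : [:: a; b; c] =i [:: x; y; z] -> \dim (roots_field a b c) = r.
  exact: dim_roots_field_perm.
have := frob_cases xyz cp p23; rewrite !inE !xpair_eqE.
case/or4P => [|||/or3P[]] /andP[/andP[/eqP fx /eqP fy] /eqP fz].
- constructor 1; split; first exact: dim_fixed.
  by rewrite fx fy fz.
- constructor 2; split; first by apply: dim_swap.
  by constructor 1; rewrite fx fy fz.
- constructor 2; split; last by constructor 2; rewrite fx fy fz.
  rewrite -(perm y z x); last by move=> u; rewrite !inE orbA orbC.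
  exact: (dim_swap p_pr yzx).
- constructor 2; split; last by constructor 3; rewrite fx fy fz.
  rewrite -(perm z x y); last by move=> u; rewrite !inE orbC -orbA.
  exact: (dim_swap p_pr zxy).
- constructor 3; split; last by left.
  exact: (dim_cycle p_pr xyz).
- constructor 3; split; last by right.
  rewrite -(perm x z y); last by move=> u; rewrite !inE; congr (_ || _); rewrite orbC.
  by apply: (dim_cycle p_pr xzy); rewrite // eq_sym.
Qed.

(** The symbol argument lives in [Fbar p], and naturals carry its conclusion to [L]. The primes left
    out of it are settled directly: [23 = 0^2 + 23 * 1^2], while for 2 and 3 both sides fail. *)
Theorem fixed_iff_form (x y z : L) : padovan_roots x y z ->
  [/\ x ^+ p = x, y ^+ p = y & z ^+ p = z] <->
  exists X Y : int, p%:Z = X ^+ 2 + 23%:Z * Y ^+ 2.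
Proof.
move=> xyz.
have yzx := padovan_roots_rot xyz; have zxy := padovan_roots_rot yzx.
have [p23|p23] := eqVneq p 23%N.
  split=> _; first by exists 0, 1; rewrite p23.
  by split; [exact: padovan_roots_fixed23 xyz|
    exact: padovan_roots_fixed23 yzx|exact: padovan_roots_fixed23 zxy].
have [small|] := boolP ((p == 2%N) || (p == 3%N)).
  have {}small : p = 2%N \/ p = 3%N by case/orP: small => /eqP->; [left|right].
  split=> [[fx _ _]|[X [Y /(no_small_form small)]] //].
  by case: (no_fixed_root cp small fx (padovan_root1 xyz)).
rewrite negb_or => /andP[p2 p3].
have cb := Fbar_char p_pr.
split=> [[/(frob_fixed_nat cp)[a aE] /(frob_fixed_nat cp)[b bE] /(frob_fixed_nat cp)[c cE]]|[X [Y pE]]].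
  have abc : padovan_roots (a%:R : Fbar p) b%:R c%:R.
    by apply/(padovan_roots_nat _ _ _ cb)/(padovan_roots_nat _ _ _ cp); rewrite -aE -bE -cE.
  by apply: (fixed_principal_form p_pr p2 p3 abc); exact: frob_nat.
have [x' [y' [z' xyz']]] := closed_padovan_roots (Fbar p).
have [] := principal_form_fixed p_pr p2 p3 p23 xyz' pE.
move=> /(frob_fixed_nat cb)[a aE] /(frob_fixed_nat cb)[b bE] /(frob_fixed_nat cb)[c cE].
have abc : padovan_roots (a%:R : L) b%:R c%:R.
  by apply/(padovan_roots_nat _ _ _ cp)/(padovan_roots_nat _ _ _ cb); rewrite -aE -bE -cE.
have fixed (u : L) : u ^+ 3 - u - 1 = 0 -> u ^+ p = u.
  by move/(padovan_rootP abc) => [] ->; exact: frob_nat.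
by split; apply: fixed; [exact: padovan_root1 xyz|exact: padovan_root1 yzx|exact: padovan_root1 zxy].
Qed.

End Classify.

(** * Orders of the roots according to the Frobenius permutation *)

Section Orders.
Variables (p : nat) (p_pr : prime p) (L : fieldExtType 'F_p).
Let cp := fieldExt_char L p_pr.
Local Notation o := (@mult_order p L).

Lemma mult_order_frob (x : L) : x != 0 -> (o (x ^+ p) %| o x)%N.
Proof.
move=> x0; rewrite -mult_orderP ?expf_neq0 // -exprM mulnC exprM.
by rewrite expr_mult_order // expr1n.
Qed.

Variables x y z : L.
Hypotheses (xyz : padovan_roots x y z) (p23 : p != 23%N).

Let x0 : x != 0. Proof. by have [] := padovan_roots_neq0 xyz. Qed.
Let y0 : y != 0. Proof. by have [] := padovan_roots_neq0 xyz. Qed.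
Let z0 : z != 0. Proof. by have [] := padovan_roots_neq0 xyz. Qed.
Let cyc : x * y * z = 1. Proof. by case: xyz. Qed.

Lemma period_lcm : period p_pr = lcmn (lcmn (o x) (o y)) (o z).
Proof.
have tP n : is_period p n = (0 < n)%N && (lcmn (lcmn (o x) (o y)) (o z) %| n)%N.
  by rewrite (is_period_roots _ cp p23 xyz) !dvdn_lcm !mult_orderP // -andbA.
have l0 : (0 < lcmn (lcmn (o x) (o y)) (o z))%N.
  by rewrite !lcmn_gt0 !mult_order_gt0.
apply/eqP; rewrite eqn_leq period_min /=; last by rewrite tP l0 dvdnn.
by have := period_is_period p_pr; rewrite tP => /andP[t0 /(dvdn_leq t0)].
Qed.

Section Swap.
Hypotheses (fx : x ^+ p = x) (fy : y ^+ p = z) (fz : z ^+ p = y).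

(** The norm of [y] to the prime field is [y z], the inverse of [x]. *)
Let yX n : y ^+ ((p + 1) * n) = (x ^+ n)^-1.
Proof.
rewrite exprM exprD fy expr1 -exprVn; congr (_ ^+ _).
by apply: (mulfI x0); rewrite mulfV // -cyc; ring.
Qed.

Let zX n : z ^+ ((p + 1) * n) = (x ^+ n)^-1.
Proof.
rewrite exprM exprD fz expr1 -exprVn; congr (_ ^+ _).
by apply: (mulfI x0); rewrite mulfV // -cyc; ring.
Qed.

Lemma swap_orders : o z = o y /\ (o x %| o y)%N.
Proof.
split.
  apply/eqP; rewrite eqn_dvd.
  by rewrite -{1}fy -[in X in _ && X]fz !mult_order_frob.
rewrite -mult_orderP // -invr_eq1 -yX mulnC exprM expr_mult_order //.
by rewrite expr1n.
Qed.

Lemma swap_period : period p_pr = o y.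
Proof.
have [oz xy] := swap_orders; rewrite period_lcm oz.
apply/eqP; rewrite eqn_dvd !dvdn_lcm xy !dvdnn /=.
by rewrite dvdn_lcmr.
Qed.

Lemma swap_dvd : (o y %| (p + 1) * o x)%N.
Proof. by rewrite -mult_orderP // yX expr_mult_order // invr1. Qed.

(** Let [N = (p + 1) k] with [k] the order of [x ^+ 3]. Then [y ^+ N] and [z ^+ N] are [x ^- k], and
    so is [x ^+ N = x ^+ (2 * k)]. A quadratic expression in the roots is thus constant on all
    three, and its leading coefficient, the Padovan number of index [N - 3], vanishes. This index is
    positive because the cubic has no root modulo 2. *)
Lemma swap_omega : (omega p_pr <= (p + 1) * o (x ^+ 3)%R - 3)%N.
Proof.
set k := o _; have k0 : (0 < k)%N := mult_order_gt0 _.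
have p2 : p != 2%N.
  apply/eqP => p2.
  by case: (no_fixed_root cp (or_introl p2) fx (padovan_root1 xyz)).
have p3 : (3 <= p)%N by move: p2 (prime_gt1 p_pr); clear; lia.
have [n nE] : exists n, ((p + 1) * k = n.+1 + 3)%N.
  by exists ((p + 1) * k - 4)%N; nia.
rewrite nE addnK; apply: omega_min; rewrite inE /= -(natr_eq0_char _ cp).
pose c := (x ^+ k)^-1.
have xX : x ^+ ((p + 1) * k) = c.
  rewrite exprM exprD fx expr1 /c -exprVn.
  have : x ^+ 3 ^+ k = 1 by rewrite expr_mult_order // expf_neq0.
  move=> x3; apply: (mulfI (expf_neq0 k x0)).
  rewrite exprVn mulfV ?expf_neq0 // -exprMn -x3.
  by congr (_ ^+ _); ring.
have yzx := padovan_roots_rot xyz; have zxy := padovan_roots_rot yzx.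
have h (u v t : L) : padovan_roots u v t -> u ^+ ((p + 1) * k) = c ->
   (padovan n.+1)%:R * u ^+ 2 + (padovan n.+2)%:R * u
                 + ((padovan n.+3)%:R - (padovan n.+1)%:R - c) = 0.
  move=> uvt; rewrite nE padovan_expr; first by move=> <-; ring.
  by have /eqP := padovan_root1 uvt; rewrite -addrA -opprD subr_eq0 => /eqP.
have [xy yz zx] := roots_neq xyz cp p23.
have [-> _ _] := quadratic_eq0 xy yz zx (h _ _ _ xyz xX) (h _ _ _ yzx (yX k)) (h _ _ _ zxy (zX k)).
by [].
Qed.

End Swap.

(** The orders divide one another around the cycle, so they are equal. The divisibility is the norm
    relation [x ^+ (p ^ 2 + p + 1) = z * y * x = 1]. *)
Lemma cycle_orders : x ^+ p = y -> y ^+ p = z -> z ^+ p = x ->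
  [/\ period p_pr = o x, o y = o x, o z = o x & (o x %| p ^ 2 + p + 1)%N].
Proof.
move=> fx fy fz.
have xy : (o y %| o x)%N by rewrite -fx mult_order_frob.
have yz : (o z %| o y)%N by rewrite -fy mult_order_frob.
have zx : (o x %| o z)%N by rewrite -fz mult_order_frob.
have oy : o y = o x by apply/eqP; rewrite eqn_dvd xy (dvdn_trans zx yz).
have oz : o z = o x by apply/eqP; rewrite eqn_dvd zx (dvdn_trans yz xy).
have ll n : lcmn n n = n by apply/eqP; rewrite eqn_dvd dvdn_lcm dvdnn dvdn_lcml.
split=> //; first by rewrite period_lcm oy oz !ll.
rewrite -mult_orderP // !exprD expr1 -mulnn exprM fx fy -cyc; apply/eqP; ring.
Qed.

End Orders.

Lemma period_eq23 p (p_pr : prime p) : p = 23%N -> period p_pr = 506%N.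
Proof. by move=> pE; move: (p_pr); rewrite pE; exact: period23. Qed.

Local Close Scope ring_scope.

Theorem theorem5p1 (p : nat) (p_pr : prime p)
    (L : fieldExtType 'F_p) (alpha beta gamma : L)
    (roots : padovan_poly L =
       (('X - alpha%:P) * ('X - beta%:P) * ('X - gamma%:P))%R) :
  let Rp := <<1 & [:: alpha; beta; gamma]>>%AS in
  let r := \dim Rp in
  let a := mult_order alpha in
  let b := mult_order beta in
  let c := mult_order gamma in
  let t := period p_pr in
  let w := omega p_pr in
  r \in [:: 1; 2; 3] /\
  (* 1 *)
  ([/\ t - 3 \in Omega_upto_period p_pr, t - 2 \in Omega_upto_period p_pr
      & t \in Omega_upto_period p_pr] /\
   w <= t - 3) /\
  (* 2 *)
  (forall n : nat, n \in Omega p <->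
     exists x k : nat, x \in Omega_upto_period p_pr /\ n = x + k * t) /\
  (* 3 *)
  (p <> 23 -> t = lcmn (lcmn a b) c /\ t %| p ^ r - 1) /\
  (* 4 *)
  (p = 23 -> [/\ t = 506, t = p * (p - 1) & r = 1]) /\
  (* 5 (i) *)
  (r = 1 <-> exists x y : int, (p%:Z = x ^+ 2 + 23%:Z * y ^+ 2)%R) /\
  (* 5 (ii) *)
  (r = 2 ->
     (exists x : 'F_p, root (padovan_poly 'F_p) x) /\
     (alpha \in 1%VS ->
        [/\ t = b, t = c, b %| (p + 1) * a &
            w <= (p + 1) * mult_order (alpha ^+ 3)%R - 3])) /\
  (* 5 (iii) *)
  (r = 3 ->
     [/\ t = a, t = b, t = c, t %| (p ^ 3 - 1) %/ (p - 1) &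
         (p ^ 3 - 1) %/ (p - 1) = p ^ 2 + p + 1]).
Proof.
move=> Rp r a b c t w.
have xyz : padovan_roots alpha beta gamma := padovan_roots_of_poly roots.
have yzx := padovan_roots_rot xyz; have zxy := padovan_roots_rot yzx.
have cp := fieldExt_char L p_pr.
have [x0 y0 z0] := padovan_roots_neq0 xyz.
pose fixed := [/\ alpha ^+ p = alpha, beta ^+ p = beta & gamma ^+ p = gamma]%R.
have dim1 : fixed -> r = 1 by case; exact: dim_fixed.
have fixed23 : p = 23 -> fixed.
  by move=> p23; split; [exact: padovan_roots_fixed23 xyz|
    exact: padovan_roots_fixed23 yzx|exact: padovan_roots_fixed23 zxy].
have rP : fixed /\ r = 1 \/ ~ fixed /\ (r = 2 \/ r = 3) /\ p != 23.
  have [p23|p23] := eqVneq p 23; first by left; split; auto.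
  case: (roots_trichotomy p_pr xyz p23) => -[rE h]; first by left.
    right; split; last by split=> //; left.
    by move/dim1; rewrite /r rE.
  right; split; last by split=> //; right.
  by move/dim1; rewrite /r rE.
have Tfixed (u : L) : (u ^+ p = u -> u ^+ 3 - u - 1 = 0 ->
    exists x : 'F_p, root (padovan_poly 'F_p) x)%R.
  move=> /(frob_fixed_nat cp)[n ->] /eqP un; exists (n%:R)%R.
  rewrite /padovan_poly rootE !hornerE.
  move: un; rewrite -!addrA -!opprD !subr_eq0 -!natrX !natr1.
  by rewrite (natr_eq_char _ _ cp) (natr_eq_char _ _ (pchar_Fp p_pr)).
split; first by case: rP => [[_ ->]|[_ [[->|->] _]]].
split; first exact: Omega_period_facts.
split; first by move=> n; exact: Omega_periodic.
split.
  move=> /eqP p23; have tE := period_lcm p_pr xyz p23; split; first exact: tE.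
  have pk (k : nat) (u : L) :
      u != 0%R -> (u ^+ (p ^ k) = u)%R -> mult_order u %| p ^ k - 1.
    move=> u0 uk; rewrite -mult_orderP //; apply/eqP/(mulfI u0).
    by rewrite -exprS subn1 prednK ?expn_gt0 ?prime_gt0 // uk mulr1.
  rewrite /t tE !dvdn_lcm -andbA.
  case: (roots_trichotomy p_pr xyz p23) => -[rE h].
  - by case: h => fx fy fz; apply/and3P; split; apply: pk; rewrite // /r rE expn1.
  - have sq (u v : L) : (u ^+ p = v -> v ^+ p = u -> u ^+ (p ^ 2) = u)%R.
      by move=> uv vu; rewrite -mulnn exprM uv.
    by case: h => -[fx fy fz]; apply/and3P; split; apply: pk => //; rewrite /r rE; apply: sq; eassumption.
  - have cu (u v s : L) : (u ^+ p = v -> v ^+ p = s -> s ^+ p = u -> u ^+ (p ^ 3) = u)%R.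
      by move=> uv vs su; rewrite !expnS muln1 !exprM uv vs.
    by case: h => -[fx fy fz]; apply/and3P; split; apply: pk => //; rewrite /r rE; apply: cu; eassumption.
split.
  move=> p23; split; last exact/dim1/fixed23.
    by rewrite /t period_eq23.
  by rewrite /t period_eq23 // p23.
split.
  split=> [r1|/(fixed_iff_form p_pr xyz)/dim1 //]; apply/(fixed_iff_form p_pr xyz).
  by case: rP => [[]//|[_ [[rE|rE] _]]]; rewrite r1 in rE.
split=> r23.
  have p23 : p != 23 by case: rP => [[_ rE]|[_ [_ //]]]; rewrite r23 in rE.
  case: (roots_trichotomy p_pr xyz p23) => -[rE h]; rewrite -/r r23 // in rE *.
  have [xy yz zx] := roots_neq xyz cp p23.
  split.
    case: h => -[fx fy fz].
    - exact: Tfixed fx (padovan_root1 xyz).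
    - exact: Tfixed fx (padovan_root1 yzx).
    - exact: Tfixed fx (padovan_root1 zxy).
  move/(frob_fixedP p_pr) => fa.
  (* Frobenius is a transposition fixing [alpha]; either of the two that move [alpha] would identify
     distinct roots. *)
  have [fb fc] : (beta ^+ p = gamma /\ gamma ^+ p = beta)%R.
    case: h => -[f1 f2 f3] //.
      by move: zx; rewrite -f3 fa eqxx.
    by move: xy; rewrite -f2 fa eqxx.
  have [oz _] := swap_orders xyz fb fc.
  have tb := swap_period p_pr xyz p23 fb fc.
  split; rewrite ?/t ?tb //.
    exact: swap_dvd xyz fb.
  exact: (swap_omega p_pr xyz p23 fa fb fc).
have p23 : p != 23 by case: rP => [[_ rE]|[_ [_ //]]]; rewrite r23 in rE.
have pE : (p ^ 3 - 1) %/ (p - 1) = p ^ 2 + p + 1.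
  have p1 := prime_gt1 p_pr.
  have -> : p ^ 3 - 1 = (p ^ 2 + p + 1) * (p - 1) by clear -p1; nia.
  by rewrite mulnK // subn_gt0.
case: (roots_trichotomy p_pr xyz p23) => -[rE h]; rewrite -/r r23 // in rE *.
case: h => -[fa fb fc].
  have [ta ba ca d] := cycle_orders p_pr xyz p23 fa fb fc.
  by rewrite pE /t ta /b /c ba ca.
have [ta ba ca d] := cycle_orders p_pr (padovan_roots_swap xyz) p23 fa fb fc.
by rewrite pE /t ta /b /c ba ca.
Qed.
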